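(* Let $(E,\delta)$ be a differential extension of $(\mathbb{C}(x),d/dx)$ whose field of constants is $\mathbb{C}$, and let $\ell\in E$ be transcendental over $\mathbb{C}(x)$ with $\delta(\ell)=1/x$ (symbolically $\ell=\log(x)$). Let $f\in\mathbb{C}(x)$ and $T=f\cdot\ell$. Then $T$ is stable over the elementary extensions of $\mathbb{C}(x)(\ell)$ if and only if $f\in\mathbb{C}[x,x^{-1}]$.
   Context: All fields have characteristic zero. A differential field $(K,\delta)$ is a field with an additive map $\delta$ satisfying the Leibniz rule; a differential extension $(E,\delta)\supseteq(k,\delta)$ is a field extension whose derivation restricts to that of $k$. For such an extension, $t\in E$ is elementary over $k$ if (a) $t$ is algebraic over $k$, or (b) $t\neq 0$ and $\delta(t)/t=\delta(a)$ for some $a\in k$, or (c) $\delta(t)=\delta(a)/a$ for some $a\in k\setminus\{0\}$. $E$ is an elementary extension of $k$ if $E=k(t_1,\dots,t_n)$ with each $t_i$ elementary over $k(t_1,\dots,t_{i-1})$. An element $f$ of a differential field $K$ is stable over the elementary extensions of $K$ if there is a sequence $(g_i)_{i\in\mathbb{N}}$ such that each $g_i$ lies in some elementary extension of $K$ and $f=\delta^i(g_i)$ for all $i\in\mathbb{N}$. *)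

(* Defs.v *)
From HB Require Import structures.
From mathcomp Require Import all_boot all_order all_algebra.
From mathcomp Require Import fraction.
From mathcomp Require Import complex.
From mathcomp Require Import reals.
Set Implicit Arguments. Unset Strict Implicit. Unset Printing Implicit Defensive.
Import Order.TTheory GRing.Theory Num.Theory.
Local Open Scope ring_scope.

Definition is_derivation (F : fieldType) (d : F -> F) : Prop :=
  (forall a b, d (a + b) = d a + d b) /\ (forall a b, d (a * b) = d a * b + a * d b).

Definition subfield_closed (F : fieldType) (P : F -> Prop) : Prop :=
  [/\ P 1, (forall a b, P a -> P b -> P (a - b)),
      (forall a b, P a -> P b -> P (a * b)) & (forall a, P a -> P a^-1)].

Definition gen_field (F : fieldType) (S : F -> Prop) (e : F) : Prop :=
  forall P : F -> Prop, subfield_closed P -> (forall s, S s -> P s) -> P e.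

Definition elementary_over (L : fieldType) (d : L -> L) (k : L -> Prop) (t : L) : Prop :=
  (exists p : {poly L}, [/\ p != 0, (forall i, k p`_i) & root p t])
  \/ (t != 0 /\ exists a, k a /\ d t / t = d a)
  \/ (exists a, [/\ k a, a != 0 & d t = d a / a]).

(* j : F -> L restricts on the differential subfield K of (F, dF) to a
   differential field embedding K -> (L, dL) (its values off K are irrelevant). *)
Definition diff_embedding_on (F L : fieldType) (dF : F -> F) (dL : L -> L)
    (K : F -> Prop) (j : F -> L) : Prop :=
  [/\ j 1 = 1,
      (forall a b, K a -> K b -> j (a + b) = j a + j b),
      (forall a b, K a -> K b -> j (a * b) = j a * j b)
    & (forall a, K a -> j (dF a) = dL (j a))].

Definition elementary_extension (F L : fieldType) (K : F -> Prop) (j : F -> L)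
    (dL : L -> L) : Prop :=
  let base (s : seq L) := gen_field (fun z => (exists e, K e /\ z = j e) \/ z \in s) in
  exists ts : seq L,
    (forall y : L, base ts y) /\
    (forall i, (i < size ts)%N -> elementary_over dL (base (take i ts)) (nth 0 ts i)).

Definition stable_over_elementary (F : fieldType) (dF : F -> F) (K : F -> Prop) (f : F)
  : Prop :=
  forall i : nat, exists (L : fieldType) (dL : L -> L) (j : F -> L),
    [/\ is_derivation dL, diff_embedding_on dF dL K j, elementary_extension K j dL
      & exists g : L, j f = iter i dL g].

Notation "x %:F" := (@FracField.tofrac _ x) : ring_scope.

(* Main.v *)
(* A polynomial p in x and integration by parts turn stability of f*l into: p*f*l has
   an elementary primitive for every p. If f had a pole a <> 0, a suitable p would make
   P/(x-a)*l elementarily integrable with P(a) <> 0. By Liouville's theorem, applied over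
   the field C'(x)(l) where C' is the field of all constants of the extension, this gives
   P/(x-a) = v' + c/x with v in C'(x), which is impossible at the simple pole a.
   Conversely C[x,1/x,l] is closed under integration.
   One Liouville step from F to F(t): for t algebraic, take traces in a matrix
   representation of F(t), which commute with the derivation up to a commutator; for t
   transcendental, compare both sides modulo the elements of negative degree in t. *)
Require Import Defs.
From HB Require Import structures.
From mathcomp Require Import all_boot all_order all_algebra.
From mathcomp Require Import generic_quotient fraction complex reals.
From mathcomp Require Import boolp ring.
Import Order.TTheory GRing.Theory Num.Theory.
Set Implicit Arguments. Unset Strict Implicit. Unset Printing Implicit Defensive.
Local Open Scope ring_scope.

(** * Subfields and derivations *)

(** The extensions allowed in the definition of stability may contain new constants. Once the base
    contains them all, a coefficient of a logarithmic term, or a difference t - u of zero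
    derivative, lies in the base by construction. The valuation at infinity treats logarithms and
    exponentials alike, since in both cases the derivative of t is a polynomial of degree at most 1
    in t; no factorization or partial fractions over F(t) are needed. Trace and determinant replace
    sums and products over conjugates, so no normal closure is built. One level of stability
    suffices for a given pole: if f*l is the n-th derivative of g and p has degree below n,
    integration by parts makes p*f*l a derivative in the same extension. The multiplier p is the
    denominator of f with one factor x - a removed, and P is the numerator of f. *)

Section SubfieldType.
Variables (L : fieldType) (P : L -> Prop) (HP : subfield_closed P).

Definition subfield_mem of subfield_closed P : {pred L} := fun y => `[< P y >].

Lemma subfield_memP y : reflect (P y) (y \in subfield_mem HP).
Proof. exact: asboolP. Qed.

Lemma subfield_mem_divring : divring_closed (subfield_mem HP).
Proof.
have [P1 PB PM PV] := HP; split; first exact/subfield_memP.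
  by move=> a b /subfield_memP Pa /subfield_memP Pb; apply/subfield_memP/PB.
move=> a b /subfield_memP Pa /subfield_memP Pb.
by apply/subfield_memP/PM => //; apply: PV.
Qed.
HB.instance Definition _ :=
  GRing.isDivringClosed.Build L (subfield_mem HP) subfield_mem_divring.

Definition subfield_type := {y : L | y \in subfield_mem HP}.
HB.instance Definition _ := [isSub of subfield_type for sval].
HB.instance Definition _ := [Choice of subfield_type by <:].
HB.instance Definition _ := [SubChoice_isSubComUnitRing of subfield_type by <:].
HB.instance Definition _ :=
  [SubComUnitRing_isSubIntegralDomain of subfield_type by <:].
HB.instance Definition _ := [SubIntegralDomain_isSubField of subfield_type by <:].

End SubfieldType.

(** Polynomials and matrices need a coefficient type, so a subfield given by a predicate is realised
    as a field with a morphism into [L]. *)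
Lemma subfield_image (L : fieldType) (P : L -> Prop) : subfield_closed P ->
  exists (F : fieldType) (i : {rmorphism F -> L}),
    forall y, P y <-> exists u, y = i u.
Proof.
move=> HP; exists (subfield_type HP), (val : {rmorphism subfield_type HP -> L}).
move=> y; split=> [Py | [u ->]]; last exact/(subfield_memP HP)/(valP u).
have Hy : y \in subfield_mem HP by apply/subfield_memP.
by exists (exist _ y Hy).
Qed.

Section GenField.
Variable L : fieldType.
Implicit Types (P S : L -> Prop) (a b : L).

Lemma subfield1 P : subfield_closed P -> P 1. Proof. by case. Qed.
Lemma subfieldB P a b : subfield_closed P -> P a -> P b -> P (a - b).
Proof. by case=> _ H _ _; apply: H. Qed.
Lemma subfieldM P a b : subfield_closed P -> P a -> P b -> P (a * b).
Proof. by case=> _ _ H _; apply: H. Qed.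
Lemma subfieldV P a : subfield_closed P -> P a -> P a^-1.
Proof. by case=> _ _ _ H; apply: H. Qed.
Lemma subfield0 P : subfield_closed P -> P 0.
Proof. by move=> HP; rewrite -(subrr 1); apply: subfieldB => //; apply: subfield1. Qed.
Lemma subfieldN P a : subfield_closed P -> P a -> P (- a).
Proof. by move=> HP Pa; rewrite -sub0r; apply: subfieldB => //; apply: subfield0. Qed.
Lemma subfieldD P a b : subfield_closed P -> P a -> P b -> P (a + b).
Proof. by move=> HP Pa Pb; rewrite -[b]opprK; apply: subfieldB => //; apply: subfieldN. Qed.
Lemma subfieldX P a n : subfield_closed P -> P a -> P (a ^+ n).
Proof.
move=> HP Pa; elim: n => [|n IH]; first exact: subfield1.
by rewrite exprS; apply: subfieldM.
Qed.

Lemma gen_field_closed S : subfield_closed (gen_field S).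
Proof.
split.
- by move=> P HP _; apply: subfield1.
- by move=> a b Sa Sb P HP HS; apply: subfieldB => //; [apply: Sa | apply: Sb].
- by move=> a b Sa Sb P HP HS; apply: subfieldM => //; [apply: Sa | apply: Sb].
- by move=> a Sa P HP HS; apply: subfieldV => //; apply: Sa.
Qed.

Lemma mem_gen_field S s : S s -> gen_field S s.
Proof. by move=> Ss P _; apply. Qed.

Lemma gen_field_sub S P : subfield_closed P -> (forall s, S s -> P s) ->
  forall y, gen_field S y -> P y.
Proof. by move=> HP HS y; apply. Qed.

End GenField.

Section DerivationTheory.
Variables (L : fieldType) (d : L -> L).
Hypothesis Hd : is_derivation d.

Lemma derD a b : d (a + b) = d a + d b. Proof. by case: Hd. Qed.
Lemma derM a b : d (a * b) = d a * b + a * d b. Proof. by case: Hd. Qed.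
Lemma der0 : d 0 = 0.
Proof. by apply: (addrI (d 0)); rewrite -derD !addr0. Qed.
Lemma derN a : d (- a) = - d a.
Proof. by apply: (addrI (d a)); rewrite -derD !subrr der0. Qed.
Lemma derB a b : d (a - b) = d a - d b. Proof. by rewrite derD derN. Qed.
Lemma der1 : d 1 = 0.
Proof. by apply: (addrI (d 1)); rewrite -{3}(mulr1 1) derM mulr1 mul1r addr0. Qed.
Lemma der_sum (I : Type) (r : seq I) (Q : pred I) (f : I -> L) :
  d (\sum_(k <- r | Q k) f k) = \sum_(k <- r | Q k) d (f k).
Proof. exact: (big_morph d derD der0). Qed.
Lemma derV a : d a^-1 = - (d a / a ^+ 2).
Proof.
have [->|a0] := eqVneq a 0; first by rewrite invr0 der0 mul0r oppr0.
have := der1; rewrite -(divff a0) derM => /(canRL (addKr _)).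
rewrite addr0 => /(congr1 ( *%R a^-1)); rewrite mulKf // => ->.
by field.
Qed.
Lemma der_div a b : b != 0 -> d (a / b) = (d a * b - a * d b) / b ^+ 2.
Proof. by move=> b0; rewrite derM derV; field. Qed.
Lemma derX a n : d (a ^+ n) = n%:R * a ^+ n.-1 * d a.
Proof.
elim: n => [|n IH]; first by rewrite expr0 der1 !mul0r.
rewrite exprS derM IH /= -natr1; case: n {IH} => [|n] /=; first by rewrite expr0; ring.
rewrite exprS; ring.
Qed.
Lemma der_nat n : d n%:R = 0.
Proof. by elim: n => [|n IH]; rewrite ?der0 // -natr1 derD der1 addr0. Qed.

Lemma const_closed : subfield_closed (fun c => d c = 0).
Proof.
split; first exact: der1.
- by move=> a b a0 b0; rewrite derB a0 b0 subrr.
- by move=> a b a0 b0; rewrite derM a0 b0 mul0r mulr0 addr0.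
- by move=> a a0; rewrite derV a0 mul0r oppr0.
Qed.

Lemma der_gen_field (S : L -> Prop) :
  (forall s, S s -> gen_field S (d s)) -> forall y, gen_field S y -> gen_field S (d y).
Proof.
move=> HS y Sy; have HG := gen_field_closed S.
have [//] : gen_field S y /\ gen_field S (d y).
apply: (gen_field_sub (P := fun y => gen_field S y /\ gen_field S (d y))) Sy;
  last by move=> s Ss; split; [apply: mem_gen_field | apply: HS].
split.
- by rewrite der1; split; [exact: (subfield1 HG) | exact: (subfield0 HG)].
- by move=> a b [? ?] [? ?]; rewrite derB; split; exact: (subfieldB HG).
- move=> a b [? ?] [? ?]; rewrite derM; split; first exact: (subfieldM HG).
  by apply: (subfieldD HG); apply: (subfieldM HG).
- move=> a [? ?]; rewrite derV; split; first exact: (subfieldV HG).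
  apply: (subfieldN HG); apply: (subfieldM HG) => //; apply: (subfieldV HG).
  exact: (subfieldX 2 HG).
Qed.

End DerivationTheory.

Lemma der_restrict (F L : fieldType) (i : {rmorphism F -> L}) (d : L -> L) :
  is_derivation d -> (forall u, exists v, d (i u) = i v) ->
  exists dF : F -> F, is_derivation dF /\ forall u, d (i u) = i (dF u).
Proof.
move=> Hd /choice [dF HdF]; exists dF; split=> //; split=> a b; apply: (fmorph_inj i).
  by rewrite -HdF !rmorphD derD // !HdF.
by rewrite -HdF rmorphD !rmorphM derM // !HdF.
Qed.

(** * Liouville forms and the valuation at infinity *)

Section LiouvilleForm.
Variables (L : fieldType) (d : L -> L).
Hypothesis Hd : is_derivation d.

(** The sums of c u'/u in Liouville's theorem, with arbitrary constants of [L] as coefficients; that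
    these lie in the base is arranged by the later choice of [P]. *)
Inductive log_span (P : L -> Prop) : L -> Prop :=
| log_span0 : log_span P 0
| log_spanS c u w : d c = 0 -> P u -> u != 0 -> log_span P w ->
    log_span P (c * (d u / u) + w).

Definition liouville_form (P : L -> Prop) (f : L) : Prop :=
  exists w v, [/\ log_span P w, P v & f = w + d v].

Lemma log_spanD P w1 w2 : log_span P w1 -> log_span P w2 -> log_span P (w1 + w2).
Proof.
move=> H1 H2; elim: H1 => [|c u w c0 Pu u0 _ IH]; first by rewrite add0r.
by rewrite -addrA; apply: log_spanS.
Qed.

Lemma log_spanZ P c w : d c = 0 -> log_span P w -> log_span P (c * w).
Proof.
move=> c0; elim=> [|c' u w' c'0 Pu u0 _ IH]; first by rewrite mulr0; apply: log_span0.
rewrite mulrDr mulrA; apply: log_spanS => //.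
exact: (subfieldM (const_closed Hd)).
Qed.

Lemma log_span_sub (P Q : L -> Prop) w :
  (forall y, P y -> Q y) -> log_span P w -> log_span Q w.
Proof.
move=> PQ; elim=> [|c u w' c0 Pu u0 _ IH]; first exact: log_span0.
by apply: log_spanS => //; apply: PQ.
Qed.

Lemma liouville_form_sub (P Q : L -> Prop) f :
  (forall y, P y -> Q y) -> liouville_form P f -> liouville_form Q f.
Proof.
move=> PQ [w [v [Hw Pv ->]]]; exists w, v; split=> //; last exact: PQ.
exact: log_span_sub Hw.
Qed.

Variable P : L -> Prop.
Hypothesis HP : subfield_closed P.

Lemma liouville_form0 : liouville_form P 0.
Proof.
exists 0, 0; rewrite (der0 Hd) addr0; split=> //; first exact: log_span0.
exact: subfield0.
Qed.

Lemma liouville_form_der v : P v -> liouville_form P (d v).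
Proof. by move=> Pv; exists 0, v; rewrite add0r; split=> //; apply: log_span0. Qed.

Lemma liouville_form_log c u : d c = 0 -> P u -> u != 0 ->
  liouville_form P (c * (d u / u)).
Proof.
move=> c0 Pu u0; exists (c * (d u / u) + 0), 0; rewrite (der0 Hd) !addr0.
split=> //; last exact: subfield0.
by rewrite -[X in log_span _ X]addr0; apply: log_spanS => //; apply: log_span0.
Qed.

Lemma liouville_formD f g :
  liouville_form P f -> liouville_form P g -> liouville_form P (f + g).
Proof.
move=> [w1 [v1 [Hw1 Pv1 ->]]] [w2 [v2 [Hw2 Pv2 ->]]].
exists (w1 + w2), (v1 + v2); rewrite (derD Hd) addrACA; split=> //.
  exact: log_spanD.
exact: subfieldD.
Qed.

Lemma liouville_formZ c f : d c = 0 -> P c ->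
  liouville_form P f -> liouville_form P (c * f).
Proof.
move=> c0 Pc [w [v [Hw Pv ->]]]; exists (c * w), (c * v).
rewrite (derM Hd) c0 mul0r add0r mulrDr; split=> //; first exact: log_spanZ.
exact: subfieldM.
Qed.

End LiouvilleForm.

Lemma size_mul_lt (F : idomainType) (u v w : {poly F}) :
  v != 0 -> w != 0 -> (size u < size v)%N -> (size (u * w)%R < size (v * w)%R)%N.
Proof.
move=> v0 w0 su; rewrite (size_mul v0 w0).
apply: (leq_ltn_trans (size_polyMleq u w)); move: w0; rewrite -size_poly_gt0.
by case: (size w) => // n _; rewrite !addnS /= ltn_add2r.
Qed.

Lemma size_gt_neq0 (F : idomainType) (u v : {poly F}) : (size u < size v)%N -> v != 0.
Proof. by rewrite -size_poly_gt0; case: (size v). Qed.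

Definition image_of (F L : fieldType) (i : {rmorphism F -> L}) (y : L) : Prop :=
  exists u, y = i u.

Lemma image_of_closed (F L : fieldType) (i : {rmorphism F -> L}) :
  subfield_closed (image_of i).
Proof.
split; first by exists 1; rewrite rmorph1.
- by move=> _ _ [u ->] [v ->]; exists (u - v); rewrite rmorphB.
- by move=> _ _ [u ->] [v ->]; exists (u * v); rewrite rmorphM.
- by move=> _ [u ->]; exists u^-1; rewrite fmorphV.
Qed.

Section TranscendentalStep.
Variables (F L : fieldType) (i : {rmorphism F -> L}) (d : L -> L) (dF : F -> F).
Hypotheses (Hd : is_derivation d) (HdF : is_derivation dF).
Hypothesis Hi : forall u, d (i u) = i (dF u).
Variables (t : L) (b : {poly F}).

Definition eval_at (p : {poly F}) : L := (map_poly i p).[t].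
(** The derivation of F[t] carried over to polynomials, for a [t] whose derivative is the value of
    [b] at [t]. *)
Definition der_poly (p : {poly F}) : {poly F} := map_poly dF p + p^`() * b.
Local Notation ev := eval_at.
Local Notation D := der_poly.

Lemma evD p q : ev (p + q) = ev p + ev q.
Proof. by rewrite /ev rmorphD hornerD. Qed.
Lemma evN p : ev (- p) = - ev p.
Proof. by rewrite /ev rmorphN hornerN. Qed.
Lemma evB p q : ev (p - q) = ev p - ev q.
Proof. by rewrite evD evN. Qed.
Lemma evM p q : ev (p * q) = ev p * ev q.
Proof. by rewrite /ev rmorphM hornerM. Qed.
Lemma evC c : ev c%:P = i c.
Proof. by rewrite /ev map_polyC hornerC. Qed.
Lemma evX : ev 'X = t.
Proof. by rewrite /ev map_polyX hornerX. Qed.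
Lemma ev0 : ev 0 = 0.
Proof. by rewrite /ev rmorph0 horner0. Qed.
Lemma ev1 : ev 1 = 1.
Proof. by rewrite -[1]/(1%:P) evC rmorph1. Qed.

Definition evE := (evB, evD, evM, evN, evC, evX, ev0, ev1).

Lemma coef_der_poly p k : (D p)`_k = dF p`_k + (p^`() * b)`_k.
Proof. by rewrite coefD coef_map_id0 // (der0 HdF). Qed.

(** Placed before any assumption on [d t], so that it also serves for an algebraic [t] and for
    polynomials in [x] with constant coefficients. *)
Lemma der_ev_gen p : d (ev p) = ev (map_poly dF p) + ev p^`() * d t.
Proof.
elim/poly_ind: p => [|p c IH].
  rewrite deriv0 ev0 (der0 Hd) mul0r addr0; suff -> : map_poly dF 0 = 0 by rewrite ev0.
  by apply/polyP=> k; rewrite coef_map_id0 ?(der0 HdF) // !coef0 (der0 HdF).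
have -> : map_poly dF (p * 'X + c%:P) = map_poly dF p * 'X + (dF c)%:P.
  apply/polyP=> k; rewrite coef_map_id0 ?(der0 HdF) //.
  rewrite !coefD !coefMX !coefC !coef_map_id0 ?(der0 HdF) //.
  by case: k => [|k]; rewrite (derD HdF) ?(der0 HdF).
rewrite derivD derivM derivX derivC !evE (derD Hd) (derM Hd) IH Hi; ring.
Qed.

Hypothesis dt : d t = ev b.

Lemma der_ev p : d (ev p) = ev (D p).
Proof. by rewrite der_ev_gen dt /D !evE. Qed.

Hypothesis t_trans : forall p : {poly F}, p != 0 -> ev p != 0.

Lemma ev_inj p q : ev p = ev q -> p = q.
Proof.
move=> e; apply/eqP; rewrite -subr_eq0; apply: contraTT isT => /t_trans.
by rewrite evB e subrr eqxx.
Qed.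

Definition adjoin (y : L) : Prop :=
  gen_field (fun z => (exists u, z = i u) \/ z = t) y.

Lemma adjoin_closed : subfield_closed adjoin.
Proof. exact: gen_field_closed. Qed.

Lemma adjoin_frac y : adjoin y -> exists p q, q != 0 /\ y = ev p / ev q.
Proof.
apply: (gen_field_sub (P := fun y => exists p q, q != 0 /\ y = ev p / ev q)).
  split.
  - by exists 1, 1; rewrite oner_neq0 ev1 divr1.
  - move=> _ _ [p [q [q0 ->]]] [p' [q' [q'0 ->]]].
    exists (p * q' - p' * q), (q * q'); rewrite mulf_neq0 //; split=> //.
    by move: (t_trans q0) (t_trans q'0) => ? ?; rewrite !evE; field; apply/andP.
  - move=> _ _ [p [q [q0 ->]]] [p' [q' [q'0 ->]]].
    exists (p * p'), (q * q'); rewrite mulf_neq0 //; split=> //.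
    by rewrite !evE mulf_div.
  - move=> _ [p [q [q0 ->]]]; have [->|p0] := eqVneq p 0.
      by exists 0, 1; rewrite oner_neq0 ev0 !mul0r invr0.
    by exists q, p; rewrite invf_div.
move=> _ [[u ->]|->].
  by exists u%:P, 1; rewrite oner_neq0 !evE divr1.
by exists 'X, 1; rewrite oner_neq0 !evE divr1.
Qed.

(* The maximal ideal of the valuation at infinity of [F(t)]. *)
Definition proper (y : L) : Prop :=
  exists p q : {poly F}, (size p < size q)%N /\ y = ev p / ev q.

Lemma properD x y : proper x -> proper y -> proper (x + y).
Proof.
move=> [p [q [s ->]]] [p' [q' [s' ->]]].
have q0 := size_gt_neq0 s.
have q'0 := size_gt_neq0 s'.
exists (p * q' + p' * q), (q * q'); split; last first.
  by move: (t_trans q0) (t_trans q'0) => ? ?; rewrite !evE; field; apply/andP.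
apply: (leq_ltn_trans (size_polyD _ _)); rewrite gtn_max size_mul_lt //=.
by rewrite [q * q']mulrC size_mul_lt.
Qed.

Lemma properZ c y : proper y -> proper (i c * y).
Proof.
move=> [p [q [s ->]]]; exists (c%:P * p), q; split; last by rewrite !evE mulrA.
by rewrite mul_polyC (leq_ltn_trans (size_scale_leq _ _)).
Qed.

(** A nonzero polynomial in [t] has nonnegative degree. This turns congruences modulo [proper] into
    identities of polynomials. *)
Lemma ev_proper_eq0 p : proper (ev p) -> p = 0.
Proof.
move=> [r [q [s e]]]; have q0 := size_gt_neq0 s.
have pq : p * q = r by apply: ev_inj; rewrite evM e divfK ?t_trans.
apply: contraTeq s => p0; rewrite -leqNgt -pq size_mul //.
by move: p0; rewrite -size_poly_gt0; case: (size p) => // m _; rewrite addSn leq_addl.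
Qed.

Lemma proper0 : proper 0.
Proof. by exists 0, 1; rewrite size_poly0 size_poly1 ev0 mul0r. Qed.

Hypothesis size_b : (size b <= 2)%N.

Lemma coef_deriv_mul p k :
  (p^`() * b)`_k = b`_0 * p`_k.+1 *+ k.+1 + b`_1 * p`_k *+ k.
Proof.
have {1}-> : b = (b`_0)%:P + b`_1 *: 'X.
  apply/polyP=> -[|[|j]]; rewrite coefD coefC coefZ coefX ?mulr0 ?mulr1 ?addr0 ?add0r //.
  by rewrite nth_default // (leq_trans size_b).
rewrite mulrDr coefD coefMC coef_deriv -scalerAr coefZ coefMX mulrC mulrnAr.
by case: k => [|k] //=; rewrite ?mulr0n ?mulr0 // coef_deriv mulrnAr.
Qed.

(** Since [b] has degree at most 1, its product with the formal derivative of [p] stays within the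
    degree of [p]. The bound covers a logarithm, with [b] constant, and an exponential, with [b] a
    multiple of ['X]. *)
Lemma size_der_poly p : (size (D p) <= size p)%N.
Proof.
apply/leq_sizeP=> k sk; rewrite coef_der_poly coef_deriv_mul.
have -> : p`_k = 0 by apply: nth_default.
have -> : p`_k.+1 = 0 by apply: nth_default; apply: leqW.
by rewrite (der0 HdF) !mulr0 !mul0rn !addr0.
Qed.

Lemma proper_der y : proper y -> proper (d y).
Proof.
move=> [p [q [s ->]]]; have q0 := size_gt_neq0 s; have tq0 := t_trans q0.
exists (D p * q - p * D q), (q * q); split; last first.
  by rewrite (der_div Hd) // !der_ev !evE expr2.
apply: (leq_ltn_trans (size_polyD _ _)); rewrite size_polyN gtn_max.
rewrite size_mul_lt ?(leq_ltn_trans (size_der_poly p)) //=.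
apply: (leq_ltn_trans (size_polyMleq _ _)); rewrite size_mul //.
case: (size q) s (size_der_poly q) => // n; rewrite ltnS => sp sD.
rewrite addSn /=; have := leq_add sp sD.
by case: (size p + size (D q))%N => // m; rewrite addnS.
Qed.

Variable a : F.
Hypothesis b1 : b`_1 = dF a.
Hypothesis consts : forall c, d c = 0 -> image_of i c.

(* Replacing a polynomial by its leading term changes its logarithmic derivative
   by an element of negative degree. *)
Lemma log_der_lead (p : {poly F}) : p != 0 ->
  proper (d (ev p) / ev p
          - i (dF (lead_coef p) / lead_coef p + (size p).-1%:R * dF a)).
Proof.
move=> p0; have [n szp] : exists n, size p = n.+1.
  by exists (size p).-1; rewrite prednK // size_poly_gt0.
rewrite szp /=; set l := dF _ / _ + _.
exists (D p - l *: p), p; split; last first.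
  by rewrite der_ev evB -mul_polyC evM evC mulrBl mulfK //; exact: t_trans.
rewrite szp ltnS; apply/leq_sizeP=> k; rewrite coefB coefZ coef_der_poly coef_deriv_mul.
rewrite leq_eqVlt => /orP[/eqP<-|nk].
  have lp : lead_coef p = p`_n by rewrite lead_coefE szp.
  have : p`_n != 0 by rewrite -lp lead_coef_eq0.
  have -> : p`_n.+1 = 0 by apply: nth_default; rewrite szp.
  rewrite mulr0 mul0rn add0r b1 /l lp -[_ *+ n]mulr_natr => pn0; field.
  exact: pn0.
have -> : p`_k = 0 by apply: nth_default; rewrite szp.
have -> : p`_k.+1 = 0 by apply: nth_default; rewrite szp; apply: leqW.
by rewrite (der0 HdF) !mulr0 !mul0rn !addr0 subr0.
Qed.

(** By [log_der_lead], only the leading coefficients and degrees of the numerator and denominator of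
    each [u] survive. The former give logarithmic terms over F, the latter a constant multiple of
    [d (i a)], which is the derivative of an element of F because [consts] puts the constant in
    F. *)
Lemma log_span_adjoin w : log_span d adjoin w ->
  exists o z, [/\ liouville_form d (image_of i) (i o), proper z & w = i o + z].
Proof.
have imF := image_of_closed i.
elim=> [|c u {}w c0 Pu u0 _ [o [z [Ho Hz ->]]]].
  exists 0, 0; rewrite rmorph0 addr0; split=> //; last exact: proper0.
  exact: liouville_form0.
have [e ce] := consts c0.
have [p [q [q0 eu]]] := adjoin_frac Pu.
have p0 : p != 0 by apply: contraNneq u0 => p0; rewrite eu p0 ev0 mul0r.
pose l p := dF (lead_coef p) / lead_coef p + (size p).-1%:R * dF a.
exists (e * (l p - l q) + o).
exists (i e * ((d (ev p) / ev p - i (l p)) + i (-1) * (d (ev q) / ev q - i (l q))) + z).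
split.
- rewrite rmorphD; apply: liouville_formD => //.
  rewrite /l !(rmorphD, rmorphN, rmorphM, rmorph_nat, fmorphV) -!Hi -ce.
  set m := _%:R; set n := _%:R.
  have -> : c * (d (i (lead_coef p)) / i (lead_coef p) + m * d (i a) -
     (d (i (lead_coef q)) / i (lead_coef q) + n * d (i a))) =
     c * (d (i (lead_coef p)) / i (lead_coef p)) +
     (- c * (d (i (lead_coef q)) / i (lead_coef q)) + (c * (m - n)) * d (i a)) by ring.
  apply: liouville_formD => //; last apply: liouville_formD => //.
  + by apply: liouville_form_log => //; [exists (lead_coef p)|rewrite fmorph_eq0 lead_coef_eq0].
  + apply: liouville_form_log => //; first by rewrite (derN Hd) c0 oppr0.
      by exists (lead_coef q).
    by rewrite fmorph_eq0 lead_coef_eq0.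
  + have -> : c * (m - n) * d (i a) = d (c * (m - n) * i a).
      by rewrite !(derM Hd) c0 (derB Hd) /m /n !(der_nat Hd); ring.
    apply: liouville_form_der; apply: (subfieldM imF); last by exists a.
    by exists (e * ((size p).-1%:R - (size q).-1%:R)); rewrite rmorphM rmorphB !rmorph_nat -ce.
- apply: properD => //; apply: properZ; apply: properD; first exact: log_der_lead.
  by apply: properZ; apply: log_der_lead.
- rewrite eu; move: (t_trans p0) (t_trans q0) => tp tq.
  rewrite -ce rmorphD rmorphM rmorphB -ce rmorphN1 (der_div Hd) //.
  by field; apply/andP.
Qed.

(** Euclidean division splits [v] into a polynomial and a proper fraction, and [d] keeps the latter
    proper. The difference of the two sides is then a polynomial in [t] of negative degree, hence
    zero, and coefficients can be compared. *)
Lemma liouville_form_adjoin f : liouville_form d adjoin (ev f) ->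
  exists o v, liouville_form d (image_of i) (i o) /\ f = o%:P + D v.
Proof.
move=> [w [v [Hw /adjoin_frac [p [q [q0 ev_v]]] ef]]].
have [o [z [Ho Hz ew]]] := log_span_adjoin Hw.
exists o, (p %/ q); split=> //; apply/eqP; rewrite -subr_eq0; apply/eqP.
apply: ev_proper_eq0.
have -> : ev (f - (o%:P + D (p %/ q))) = z + d (ev (p %% q) / ev q).
  have -> : ev (p %% q) / ev q = v - ev (p %/ q).
    rewrite ev_v {2}(divp_eq p q) !evE mulrDl mulfK ?t_trans //; ring.
  rewrite (derB Hd) der_ev evB evD ef ew evC; ring.
apply: properD => //; apply: proper_der.
by exists (p %% q), q; rewrite ltn_modp.
Qed.

End TranscendentalStep.

(** * Logarithmic and exponential generators *)

Section MonomialSteps.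
Variables (F L : fieldType) (i : {rmorphism F -> L}) (d : L -> L) (dF : F -> F).
Hypotheses (Hd : is_derivation d) (HdF : is_derivation dF).
Hypothesis Hi : forall u, d (i u) = i (dF u).
Variable t : L.
Hypothesis t_trans : forall p : {poly F}, p != 0 -> eval_at i t p != 0.
Hypothesis consts : forall c, d c = 0 -> image_of i c.
Hypothesis char0 : forall n, n.+1%:R != 0 :> F.

Lemma transcendental_not_image u : t != i u.
Proof.
apply/eqP=> tu; have /t_trans/eqP : 'X - u%:P != 0 :> {poly F} by rewrite polyXsubC_eq0.
by rewrite evB evX evC tu subrr.
Qed.

(** Otherwise [t - i u] would be a constant, hence in F, and [t] with it. *)
Lemma not_der_of_primitive g u : d t = i g -> dF u != g.
Proof.
move=> dt; apply/eqP=> ug; have [c /eqP] : image_of i (t - i u).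
  by apply: consts; rewrite (derB Hd) dt Hi ug subrr.
by rewrite subr_eq -rmorphD (negPf (transcendental_not_image _)).
Qed.

Lemma coef_der_poly_primitive g p k :
  (der_poly dF g%:P p)`_k = dF p`_k + k.+1%:R * p`_k.+1 * g.
Proof. by rewrite (coef_der_poly HdF) coefMC coef_deriv mulr_natl. Qed.

(** If [p] has degree N above [m], its leading coefficient c is constant. Were N larger than
    [m + 1], the next coefficient would have derivative - N c g, and [g] would be a derivative in F,
    against [not_der_of_primitive]. *)
Lemma der_poly_primitive_bound g (p : {poly F}) m : d t = i g ->
  (forall k, (m < k)%N -> (der_poly dF g%:P p)`_k = 0) -> dF p`_m.+1 = 0.
Proof.
move=> dt Hp; case: (leqP (size p) m.+1) => [sp|].
  by rewrite nth_default ?(der0 HdF).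
case szp: (size p) => [//|n]; rewrite ltnS leq_eqVlt.
have top : (m < n)%N -> dF p`_n = 0.
  move=> mn; have := Hp n mn; rewrite coef_der_poly_primitive.
  have -> : p`_n.+1 = 0 by apply: nth_default; rewrite szp.
  by rewrite mulr0 mul0r addr0.
move=> /orP[/eqP mn|]; first by rewrite mn top // -mn.
case: n szp top => // n szp top mn.
have pn0 : p`_n.+1 != 0.
  by have := lead_coef_eq0 p; rewrite lead_coefE szp /= => ->; rewrite -size_poly_eq0 szp.
have := Hp n mn; rewrite coef_der_poly_primitive => /eqP; rewrite addr_eq0 => /eqP e.
have /eqP[] := not_der_of_primitive (- (p`_n / (n.+1%:R * p`_n.+1))) dt.
have c0 : dF (n.+1%:R * p`_n.+1) = 0.
  by rewrite (derM HdF) (der_nat HdF) top ?(ltnW mn) // mul0r mulr0 addr0.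
rewrite (derN HdF) (der_div HdF) ?mulf_neq0 ?char0 // c0 e.
by move: (n.+1%:R) (char0 n) pn0 => N N0 pn0; field; apply/andP.
Qed.

(** Degrees above 1 force the coefficient of t^2 in the polynomial part to be constant; the
    coefficient of t then gives [f]. The term [c * g] comes from t^2, whose derivative is 2 g t. *)
Lemma primitive_adjoin_linear g f : d t = i g ->
  liouville_form d (adjoin i t) (i f * t) ->
  exists v c, dF c = 0 /\ f = dF v + c * g.
Proof.
move=> dt; have -> : i f * t = eval_at i t (f%:P * 'X) by rewrite !evE.
have dt' : d t = eval_at i t g%:P by rewrite evC.
move=> /(liouville_form_adjoin Hd HdF Hi dt' t_trans) H.
(* For a primitive, [b] is constant, and its linear coefficient is the derivative of 0. *)
have [||o [p [_ e]]] := H _ 0 _ consts.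
- by rewrite (leq_trans (size_polyC_leq1 _)).
- by rewrite (der0 HdF) coefC.
have co k : (f%:P * 'X)`_k = (o%:P + der_poly dF g%:P p)`_k by rewrite e.
have p2 : dF p`_2 = 0.
  apply: (der_poly_primitive_bound dt) => k k1; have := co k.
  by rewrite coefMX coefD !coefC; case: k k1 => [|[|k]] //= _; rewrite add0r.
exists p`_1, (2%:R * p`_2); split; first by rewrite (derM HdF) (der_nat HdF) p2 mul0r mulr0 addr0.
by have := co 1%N; rewrite coefMX coefD !coefC /= add0r coef_der_poly_primitive.
Qed.

(** The linear coefficient of the polynomial part is a constant c, and c times [d t] is the new
    logarithmic term c a'/a over F. *)
Lemma liouville_step_log a f : d t = d a / a -> a != 0 -> image_of i a ->
  liouville_form d (adjoin i t) (i f) -> liouville_form d (image_of i) (i f).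
Proof.
move=> dta a0 [u au]; have imF := image_of_closed i; pose g := dF u / u.
have dt : d t = i g by rewrite dta au Hi rmorphM fmorphV.
have dt' : d t = eval_at i t g%:P by rewrite evC.
rewrite -[X in liouville_form _ (adjoin _ _) X](evC i t).
move=> /(liouville_form_adjoin Hd HdF Hi dt' t_trans) H.
have [||o [p [Ho e]]] := H _ 0 _ consts.
- by rewrite (leq_trans (size_polyC_leq1 _)).
- by rewrite (der0 HdF) coefC.
have co k : (f%:P)`_k = (o%:P + der_poly dF g%:P p)`_k by rewrite e.
have p1 : dF p`_1 = 0.
  apply: (der_poly_primitive_bound dt) => k k1; have := co k.
  by rewrite coefD !coefC; case: k k1 => [|k] //= _; rewrite add0r.
have := co 0%N; rewrite coefD !coefC /= coef_der_poly_primitive mul1r => ->.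
rewrite !rmorphD; apply: liouville_formD => //; apply: liouville_formD => //.
  by rewrite -Hi; apply: liouville_form_der; exists p`_0.
rewrite rmorphM -dt dta; apply: liouville_form_log => //; last by exists u.
by rewrite Hi p1 rmorph0.
Qed.

(** For an exponential the derivation preserves each power of [t], so the constant coefficients
    alone give the result. *)
Lemma liouville_step_exp a f : d t / t = d a -> t != 0 -> image_of i a ->
  liouville_form d (adjoin i t) (i f) -> liouville_form d (image_of i) (i f).
Proof.
move=> dta t0 [u au]; have imF := image_of_closed i; pose b := (dF u)%:P * 'X.
have dt : d t = eval_at i t b by rewrite !evE -Hi -au -dta divfK.
rewrite -[X in liouville_form _ (adjoin _ _) X](evC i t).
move=> /(liouville_form_adjoin Hd HdF Hi dt t_trans) H.
have [||o [p [Ho e]]] := H _ u _ consts.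
- by rewrite (leq_trans (size_polyMleq _ _)) // size_polyX addn2 ltnS size_polyC_leq1.
- by rewrite coefMX coefC.
have : (f%:P)`_0 = (o%:P + der_poly dF b p)`_0 by rewrite e.
rewrite coefD !coefC /= (coef_der_poly HdF) mulrA coefMX addr0 => ->.
rewrite rmorphD -Hi; apply: liouville_formD => //.
by apply: liouville_form_der; exists p`_0.
Qed.

End MonomialSteps.

(** * Algebraic extensions *)

Section DerivationMatrix.
Variables (F : fieldType) (d : F -> F).
Hypothesis Hd : is_derivation d.

Lemma der_prod (I : finType) (f : I -> F) :
  d (\prod_k f k) = \sum_k d (f k) * \prod_(j | j != k) f j.
Proof.
suff H (r : seq I) : uniq r -> d (\prod_(k <- r) f k)
    = \sum_(k <- r) d (f k) * \prod_(j <- r | j != k) f j.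
  by rewrite H ?index_enum_uniq.
elim: r => [|x r IH] /=; first by rewrite !big_nil (der1 Hd).
move=> /andP[xr ur]; rewrite !big_cons (derM Hd) IH // eqxx /=; congr (_ * _ + _).
  rewrite big_seq [RHS]big_seq_cond; apply: eq_bigl => j.
  by case jr: (j \in r) => //=; apply/esym; apply: contraNneq xr => <-.
rewrite mulr_sumr [RHS]big_seq [LHS]big_seq; apply: eq_bigr => j jr.
rewrite big_cons; case: eqVneq => [xj|_]; last by rewrite mulrCA.
by rewrite xj jr in xr.
Qed.

Lemma der_mulmx m n p (A : 'M[F]_(m, n)) (B : 'M_(n, p)) :
  map_mx d (A *m B) = map_mx d A *m B + A *m map_mx d B.
Proof.
apply/matrixP=> k l; rewrite !mxE (der_sum Hd) -big_split /=.
by apply: eq_bigr => j _; rewrite (derM Hd) !mxE.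
Qed.

(** Jacobi's formula: [N k] differentiates row [k] alone, and expanding its determinant along that
    row gives the terms of the trace that involve this row of the derivative. *)
Lemma der_det n (M : 'M[F]_n) : d (\det M) = \tr (\adj M *m map_mx d M).
Proof.
pose N k := \matrix_(l, j) (if l == k then d (M l j) else M l j).
have -> : \tr (\adj M *m map_mx d M) = \sum_k \det (N k).
  rewrite /mxtrace; under eq_bigr do rewrite mxE.
  rewrite exchange_big /=; apply: eq_bigr => k _; rewrite (expand_det_row _ k).
  apply: eq_bigr => j _; rewrite !mxE eqxx mulrC; congr (_ * (_ * \det _)).
  by apply/matrixP=> x y; rewrite !mxE [_ == k]eq_sym (negPf (neq_lift _ _)).
rewrite /determinant (der_sum Hd) exchange_big /=; apply: eq_bigr => s _.
rewrite (derM Hd) -mulr_sumr.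
have -> : d ((-1) ^+ perm.odd_perm s) = 0.
  by case: (perm.odd_perm s); rewrite ?expr0 ?expr1 ?(derN Hd) (der1 Hd) ?oppr0.
rewrite mul0r add0r der_prod; congr (_ * _); apply: eq_bigr => k _.
rewrite [RHS](bigD1 k) //= mxE eqxx; congr (_ * _).
by apply: eq_bigr => j jk; rewrite mxE (negPf jk).
Qed.

End DerivationMatrix.

Section MatrixRepresentation.
Variables (F L : fieldType) (i : {rmorphism F -> L}) (d : L -> L) (dF : F -> F).
Hypotheses (Hd : is_derivation d) (HdF : is_derivation dF).
Hypothesis Hi : forall u, d (i u) = i (dF u).
Variables (m : nat) (e : 'cV[L]_m).

(** Row k of [M] holds the coordinates over F of [u] times the k-th entry of [e]. The space spanned
    by [e] is never formed; freeness of [e] makes [M] unique. *)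
Definition mx_rep (u : L) (M : 'M[F]_m) : Prop := u *: e = map_mx i M *m e.

Hypothesis e_free : forall r : 'rV[F]_m, map_mx i r *m e = 0 -> r = 0.

Lemma mx_rep_inj u M N : mx_rep u M -> mx_rep u N -> M = N.
Proof.
move=> uM uN; apply/eqP; rewrite -subr_eq0; apply/eqP/row_matrixP=> k.
rewrite row0; apply: e_free.
by rewrite map_row map_mxB -row_mul mulmxBl -uM -uN subrr row0.
Qed.

Lemma mx_repD u v M N : mx_rep u M -> mx_rep v N -> mx_rep (u + v) (M + N).
Proof. by rewrite /mx_rep scalerDl map_mxD mulmxDl => -> ->. Qed.

Lemma mx_repN u M : mx_rep u M -> mx_rep (- u) (- M).
Proof. by rewrite /mx_rep scaleNr map_mxN mulNmx => ->. Qed.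

Lemma mx_repM u v M N : mx_rep u M -> mx_rep v N -> mx_rep (u * v) (N *m M).
Proof.
by rewrite /mx_rep => uM uN; rewrite -scalerA uN scalemxAr uM mulmxA map_mxM.
Qed.

Lemma mx_rep_scalar c : mx_rep (i c) c%:M.
Proof. by rewrite /mx_rep map_scalar_mx mul_scalar_mx. Qed.

Lemma mx_rep_unit u M : mx_rep u M -> u != 0 -> M \in unitmx.
Proof.
move=> uM u0; rewrite -row_free_unit -kermx_eq0; apply/rowV0P=> r /sub_kermxP rM.
apply: e_free; apply: (scalerI u0).
by rewrite scalemxAr uM mulmxA -map_mxM rM map_mx0 mul0mx scaler0.
Qed.

Lemma mx_repV u M : mx_rep u M -> u != 0 -> mx_rep u^-1 (invmx M).
Proof.
move=> uM u0; apply: (scalerI u0); rewrite scalerA divff // scale1r scalemxAr uM.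
by rewrite mulmxA -map_mxM mulVmx ?(mx_rep_unit uM) // map_mx1 mul1mx.
Qed.

Definition repable u := exists M, mx_rep u M.

Lemma repable_closed : subfield_closed repable.
Proof.
split.
- by exists 1%:M; rewrite -(rmorph1 i); apply: mx_rep_scalar.
- by move=> u v [M uM] [N vN]; exists (M - N); apply: mx_repD => //; apply: mx_repN.
- by move=> u v [M uM] [N vN]; exists (N *m M); apply: mx_repM.
- move=> u [M uM]; have [->|u0] := eqVneq u 0.
    by exists 0%:M; rewrite invr0 -(rmorph0 i); apply: mx_rep_scalar.
  by exists (invmx M); apply: mx_repV.
Qed.

Variable G : 'M[F]_m.
Hypothesis de : map_mx d e = map_mx i G *m e.

(** Differentiating the defining equation of [mx_rep] brings in [G] on both sides and leaves a
    commutator. *)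
Lemma mx_rep_der u M : mx_rep u M ->
  mx_rep (d u) (map_mx dF M + M *m G - G *m M).
Proof.
move=> uM; have := congr1 (map_mx d) uM.
have -> : map_mx d (u *: e) = d u *: e + u *: map_mx d e.
  by apply/matrixP=> k l; rewrite !mxE (derM Hd).
rewrite (der_mulmx Hd) de => H; rewrite /mx_rep !(map_mxD, map_mxN, mulmxDl, mulNmx).
have -> : map_mx i (map_mx dF M) = map_mx d (map_mx i M).
  by apply/matrixP=> k l; rewrite !mxE Hi.
apply: (addIr (u *: (map_mx i G *m e))); rewrite H scalemxAr uM !map_mxM !mulmxA.
by rewrite subrK.
Qed.

Lemma trace_der u M N : mx_rep u M -> mx_rep (d u) N -> \tr N = dF (\tr M).
Proof.
move=> /mx_rep_der uM /(mx_rep_inj uM) <-.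
rewrite raddfB /= mxtraceD mxtrace_mulC addrK.
by rewrite /mxtrace (der_sum HdF); apply: eq_bigr => k _; rewrite mxE.
Qed.

(** The commutator becomes [G] minus a conjugate of [G], of trace zero; what is left is Jacobi's
    formula. *)
Lemma trace_log_der u M N : mx_rep u M -> u != 0 -> mx_rep (d u / u) N ->
  \tr N = dF (\det M) / \det M.
Proof.
move=> uM u0 uN; have uV := mx_repV uM u0; have Mu := mx_rep_unit uM u0.
rewrite -(mx_rep_inj (mx_repM (mx_rep_der uM) uV) uN).
rewrite mulmxBr mulmxDr raddfB /= mxtraceD !mulmxA mulVmx // mul1mx.
rewrite [\tr (_ *m M)]mxtrace_mulC !mulmxA mulmxV // mul1mx addrK.
by rewrite /invmx Mu -scalemxAl mxtraceZ -(der_det HdF) mulrC.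
Qed.

Hypothesis consts : forall c, d c = 0 -> image_of i c.

Lemma trace_log_span w : log_span d repable w ->
  exists2 M, mx_rep w M & log_span d (image_of i) (i (\tr M)).
Proof.
elim=> [|c u {}w c0 [M uM] u0 _ [N wN HN]].
  exists 0%:M; first by rewrite -(rmorph0 i); apply: mx_rep_scalar.
  by rewrite mxtrace_scalar mul0rn rmorph0; apply: log_span0.
have [k ck] := consts c0; have uD := mx_rep_der uM.
have uL := mx_repM uD (mx_repV uM u0).
exists ((invmx M *m (map_mx dF M + M *m G - G *m M)) *m k%:M + N).
  by apply: mx_repD => //; apply: mx_repM uL; rewrite ck; apply: mx_rep_scalar.
rewrite mxtraceD rmorphD mul_mx_scalar mxtraceZ (trace_log_der uM u0 uL).
rewrite !rmorphM fmorphV -Hi -ck; apply: log_spanS => //; first by exists (\det M).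
by rewrite fmorph_eq0 -unitfE -unitmxE (mx_rep_unit uM).
Qed.

Hypothesis m_neq0 : m%:R != 0 :> F.

(** The element [i f] acts as a scalar matrix, of trace [m] times [f]. The trace turns each
    logarithmic derivative into that of a determinant over F, so dividing by [m] gives a form over
    F. *)
Lemma liouville_form_repable f :
  liouville_form d repable (i f) -> liouville_form d (image_of i) (i f).
Proof.
move=> [w [v [/trace_log_span [W wW HW] [V vV] fwv]]].
have := mx_rep_scalar f; rewrite fwv => fS.
have /(congr1 mxtrace) := mx_rep_inj fS (mx_repD wW (mx_rep_der vV)).
rewrite mxtrace_scalar [RHS]mxtraceD (trace_der vV (mx_rep_der vV)) -fwv => E.
have im := image_of_closed i.
have -> : f = m%:R^-1 * (\tr W + dF (\tr V)) by rewrite -E -[f *+ m]mulr_natl mulKf.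
rewrite rmorphM; apply: (liouville_formZ Hd im); last first.
  rewrite rmorphD -Hi; exists (i (\tr W)), (i (\tr V)); split=> //.
  by exists (\tr V).
- by exists m%:R^-1.
- by rewrite fmorphV rmorph_nat (derV Hd) (der_nat Hd) mul0r oppr0.
Qed.

(** The same trace argument without logarithmic terms; it serves to prove that [x] and [l] are
    transcendental. *)
Lemma der_repable f v : i f = d v -> repable v -> exists u, f = dF u.
Proof.
move=> fv [V vV]; exists (m%:R^-1 * \tr V).
have := mx_rep_scalar f; rewrite fv => fS.
have := trace_der vV fS; rewrite mxtrace_scalar (derM HdF) => <-.
by rewrite (derV HdF) (der_nat HdF) mul0r oppr0 mul0r add0r -[f *+ m]mulr_natl mulKf.
Qed.

End MatrixRepresentation.

Section AlgebraicStep.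
Variables (F L : fieldType) (i : {rmorphism F -> L}) (d : L -> L) (dF : F -> F).
Hypotheses (Hd : is_derivation d) (HdF : is_derivation dF).
Hypothesis Hi : forall u, d (i u) = i (dF u).
Hypothesis char0 : forall n, n.+1%:R != 0 :> F.
Variable t : L.

(** Minimal degree stands in for irreducibility: it gives both the independence of the powers of [t]
    and the nonvanishing at [t] of the formal derivative of [p]. *)
Lemma minimal_annihilator : (exists2 p : {poly F}, p != 0 & eval_at i t p = 0) ->
  exists p : {poly F}, [/\ p != 0, eval_at i t p = 0
    & forall q, q != 0 -> eval_at i t q = 0 -> (size p <= size q)%N].
Proof.
move=> [p p0 pt].
have ex : exists n, `[< exists q : {poly F}, [/\ q != 0, eval_at i t q = 0 & size q = n] >].
  by exists (size p); apply/asboolP; exists p.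
case: (ex_minnP ex) => n /asboolP[q [q0 qt <-]] min; exists q; split=> // r r0 rt.
by apply: min; apply/asboolP; exists r.
Qed.

Section Basis.
Variable p : {poly F}.
Hypotheses (p0 : p != 0) (pt : eval_at i t p = 0).
Hypothesis pmin : forall q, q != 0 -> eval_at i t q = 0 -> (size p <= size q)%N.

Let m := (size p).-1.
Let e : 'cV[L]_m := \col_k t ^+ k.

Lemma size_annihilator : (1 < size p)%N.
Proof.
rewrite ltnNge; apply: contra_neqN p0 => /size1_polyC pc.
move: pt; rewrite pc evC => /eqP; rewrite fmorph_eq0 => /eqP ->.
by rewrite polyC0.
Qed.

Lemma size_annihilatorS : size p = m.+1.
Proof. by rewrite /m prednK // (leq_trans _ size_annihilator). Qed.

Lemma ev_sum (q : {poly F}) : (size q <= m)%N ->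
  eval_at i t q = \sum_(l < m) i q`_l * t ^+ l.
Proof.
move=> sq; rewrite /eval_at (horner_coef_wide (n := m)) ?size_map_poly //.
by apply: eq_bigr => l _; rewrite coef_map.
Qed.

Lemma powers_free (r : 'rV[F]_m) : map_mx i r *m e = 0 -> r = 0.
Proof.
move=> re; apply: (can_inj rVpolyK); rewrite [rVpoly 0]raddf0.
have sr : (size (rVpoly r) <= m)%N by apply: size_poly.
apply/eqP; apply: contraTT isT => r0.
have := pmin r0; rewrite size_annihilatorS ltnNge sr; apply=> //.
rewrite ev_sum //; transitivity ((map_mx i r *m e) 0 0); last by rewrite re mxE.
by rewrite mxE; apply: eq_bigr => l _; rewrite !mxE coef_rVpoly_ord.
Qed.

Lemma ev_repable (q : {poly F}) : repable i e (eval_at i t q).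
Proof.
exists (\matrix_k poly_rV ((q * 'X^k) %% p)); apply/matrixP=> k j.
rewrite !mxE; have -> : eval_at i t q * t ^+ k = eval_at i t ((q * 'X^k) %% p).
  have : eval_at i t (q * 'X^k) = eval_at i t q * t ^+ k.
    by rewrite evM /eval_at rmorphXn /= map_polyX hornerXn.
  by move=> <-; rewrite {1}(divp_eq (q * 'X^k) p) evD evM pt mulr0 add0r.
rewrite ev_sum; last by rewrite -ltnS -size_annihilatorS ltn_modp.
by apply: eq_bigr => l _; rewrite !mxE.
Qed.

Lemma adjoin_repable y : adjoin i t y -> repable i e y.
Proof.
apply: gen_field_sub; first exact: (repable_closed powers_free).
move=> _ [[u ->]|->]; first by rewrite -(evC i t); apply: ev_repable.
by rewrite -(evX i t); apply: ev_repable.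
Qed.

Lemma ev_adjoin (q : {poly F}) : adjoin i t (eval_at i t q).
Proof.
have aC := adjoin_closed i t.
elim/poly_ind: q => [|q c IH]; first by rewrite ev0; apply: (subfield0 aC).
rewrite evD evM evX evC; apply: (subfieldD aC).
  by apply: (subfieldM aC) => //; apply: mem_gen_field; right.
by apply: mem_gen_field; left; exists c.
Qed.

(** Differentiating p(t) = 0 expresses [d t] as a quotient whose denominator, the formal derivative
    of [p] at [t], is nonzero by minimality. *)
Lemma adjoin_der_algebraic : adjoin i t (d t).
Proof.
have aC := adjoin_closed i t.
have := der_ev_gen Hd HdF Hi t p; rewrite pt (der0 Hd) => /esym/eqP.
have dp0 : eval_at i t p^`() != 0.
  have dp : p^`() != 0.
    have := size_annihilator; case sp: (size p) => [|[|n]] // _.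
    apply/eqP=> /(congr1 (fun q : {poly F} => q`_n)); rewrite coef_deriv coef0 -mulr_natl.
    apply/eqP; rewrite mulf_neq0 ?char0 //.
    by have := lead_coef_eq0 p; rewrite lead_coefE sp /= => ->.
  apply/eqP=> /(pmin dp); apply/negP; rewrite -ltnNge.
  exact: lt_size_deriv.
rewrite addrC addr_eq0 => /eqP H.
have -> : d t = - (eval_at i t (map_poly dF p) / eval_at i t p^`()).
  by rewrite -mulNr -H mulrC mulKf.
apply: (subfieldN aC); apply: (subfieldM aC); first exact: ev_adjoin.
by apply: (subfieldV aC); apply: ev_adjoin.
Qed.

Lemma der_powers : exists G : 'M[F]_m, map_mx d e = map_mx i G *m e.
Proof.
have H (k : 'I_m) : repable i e (d (t ^+ k)).
  apply: adjoin_repable; have aC := adjoin_closed i t; rewrite (derX Hd).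
  have At : adjoin i t t by apply: mem_gen_field; right.
  apply: (subfieldM aC); last exact: adjoin_der_algebraic.
  apply: (subfieldM aC); last exact: (subfieldX _ aC).
  by rewrite -(rmorph_nat i); apply: mem_gen_field; left; exists k%:R.
have {H} [W HW] := choice H.
have m0 : (0 < m)%N by rewrite -ltnS -size_annihilatorS size_annihilator.
(* Entry 0 of [e] is 1, so row 0 of the matrix of d(t^k) lists the coordinates of d(t^k) itself. *)
exists (\matrix_k row (Ordinal m0) (W k)); apply/matrixP=> k j; rewrite !mxE.
have := congr1 (fun A : 'cV_m => A (Ordinal m0) j) (HW k); rewrite !mxE expr0 mulr1 => ->.
by apply: eq_bigr => l _; rewrite !mxE.
Qed.

Lemma degree_neq0 : m%:R != 0 :> F.
Proof. by have := size_annihilator; rewrite size_annihilatorS; case: m => // n _. Qed.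

End Basis.

Hypothesis t_alg : exists2 p : {poly F}, p != 0 & eval_at i t p = 0.

Lemma adjoin_der_alg : adjoin i t (d t).
Proof.
have [p [p0 pt pmin]] := minimal_annihilator t_alg.
exact: (adjoin_der_algebraic p0 pt pmin).
Qed.

Lemma liouville_step_alg f : (forall c, d c = 0 -> image_of i c) ->
  liouville_form d (adjoin i t) (i f) -> liouville_form d (image_of i) (i f).
Proof.
move=> consts H; have [p [p0 pt pmin]] := minimal_annihilator t_alg.
have [G de] := der_powers p0 pt pmin.
apply: (liouville_form_repable Hd HdF Hi (powers_free p0 pt pmin) de consts).
  exact: (degree_neq0 p0 pt).
apply: liouville_form_sub H => y; exact: (adjoin_repable p0 pt pmin).
Qed.

Lemma der_descent_alg f v : i f = d v -> adjoin i t v -> exists u, f = dF u.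
Proof.
move=> fv Av; have [p [p0 pt pmin]] := minimal_annihilator t_alg.
have [G de] := der_powers p0 pt pmin.
apply: (der_repable Hd HdF Hi (powers_free p0 pt pmin) de _ fv).
  exact: (degree_neq0 p0 pt).
exact: (adjoin_repable p0 pt pmin).
Qed.

End AlgebraicStep.

(** * Elementary towers *)

Section Tower.
Variables (L : fieldType) (d : L -> L).
Hypothesis Hd : is_derivation d.
Hypothesis char0 : forall n, n.+1%:R != 0 :> L.

Lemma gen_field_mono (S T : L -> Prop) y :
  (forall s, S s -> gen_field T s) -> gen_field S y -> gen_field T y.
Proof. by move=> ST; apply: gen_field_sub => //; apply: gen_field_closed. Qed.

Lemma elementary_over_mono (P Q : L -> Prop) t : (forall y, P y -> Q y) ->
  elementary_over d P t -> elementary_over d Q t.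
Proof.
move=> PQ [[p [p0 Pp pt]]|[[t0 [a [Pa e]]]|[a [Pa a0 e]]]].
- by left; exists p; split=> // k; apply: PQ.
- by right; left; split=> //; exists a; split=> //; apply: PQ.
- by right; right; exists a; split=> //; apply: PQ.
Qed.

Lemma liouville_form_gen (P Q : L -> Prop) f : (forall y, P y <-> Q y) ->
  liouville_form d P f <-> liouville_form d Q f.
Proof. by move=> PQ; split; apply: liouville_form_sub => y /PQ. Qed.

(** Demanding every constant of [L] replaces the classical assumption that the extension has no new
    constants, and passes to each larger field of the tower. *)
Definition const_diff_subfield (P : L -> Prop) : Prop :=
  [/\ subfield_closed P, (forall y, P y -> P (d y)) & (forall c, d c = 0 -> P c)].

Definition adjoin_to (P : L -> Prop) (t : L) : L -> Prop :=
  gen_field (fun z => P z \/ z = t).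

Lemma sub_adjoin_to P t y : P y -> adjoin_to P t y.
Proof. by move=> Py; apply: mem_gen_field; left. Qed.

Lemma mem_adjoin_to P t : adjoin_to P t t.
Proof. by apply: mem_gen_field; right. Qed.

Lemma const_diff_subfield_image P : const_diff_subfield P ->
  exists (F : fieldType) (i : {rmorphism F -> L}) (dF : F -> F),
    [/\ is_derivation dF, forall u, d (i u) = i (dF u),
        forall y, P y <-> image_of i y, forall c, d c = 0 -> image_of i c
      & forall n, n.+1%:R != 0 :> F].
Proof.
move=> [HP dP cP]; have [F [i Pi]] := subfield_image HP.
have [|dF [HdF Hi]] := der_restrict (i := i) Hd.
  by move=> u; apply/Pi/dP/Pi; exists u.
exists F, i, dF; split=> // [c /cP /Pi //|n].
by rewrite -(fmorph_eq0 i) rmorph_nat.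
Qed.

Lemma adjoin_toE P (F : fieldType) (i : {rmorphism F -> L}) t y :
  (forall y, P y <-> image_of i y) -> adjoin_to P t y <-> adjoin i t y.
Proof.
move=> Pi; split; apply: gen_field_mono => s.
  by move=> [/Pi Ps|->]; apply: mem_gen_field; [left | right].
by move=> [Ps|->]; apply: mem_gen_field; [left; apply/Pi | right].
Qed.

Lemma const_diff_subfield_adjoin P t : const_diff_subfield P ->
  adjoin_to P t (d t) -> const_diff_subfield (adjoin_to P t).
Proof.
move=> [HP dP cP] dt; split; first exact: gen_field_closed.
  move=> y; apply: (der_gen_field Hd) => s [Ps|->//].
  by apply: sub_adjoin_to; apply: dP.
by move=> c /cP; apply: sub_adjoin_to.
Qed.

Lemma poly_image (F : fieldType) (i : {rmorphism F -> L}) (p : {poly L}) :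
  (forall k, image_of i p`_k) -> exists q, p = map_poly i q.
Proof.
move=> /choice [g Hg]; exists (\poly_(k < size p) g k); apply/polyP=> k.
rewrite coef_map coef_poly; case: ltnP => sk; first exact: Hg.
by rewrite [LHS]nth_default //; apply/esym/(rmorph0 i).
Qed.

Lemma elementary_step P t : const_diff_subfield P -> elementary_over d P t ->
  const_diff_subfield (adjoin_to P t) /\
  forall f, P f -> liouville_form d (adjoin_to P t) f -> liouville_form d P f.
Proof.
move=> HP Ht; have [F [i [dF [HdF Hi Pi consts charF]]]] := const_diff_subfield_image HP.
have adE y := adjoin_toE t y Pi.
pose algebraic := exists2 p : {poly F}, p != 0 & eval_at i t p = 0.
have alg : (exists p : {poly L}, [/\ p != 0, (forall k, P p`_k) & root p t]) -> algebraic.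
  move=> [p [p0 Pp /rootP pt]]; have [|q eq] := poly_image (i := i) (p := p).
    by move=> k; apply/Pi.
  by exists q; [rewrite -(map_poly_eq0 i) -eq | rewrite /eval_at -eq].
have trans : ~ algebraic -> forall p : {poly F}, p != 0 -> eval_at i t p != 0.
  by move=> nalg p p0; apply/eqP=> pt; apply: nalg; exists p.
have dt : adjoin_to P t (d t).
  have aC : subfield_closed (adjoin_to P t) := gen_field_closed _.
  have [_ dP _] := HP.
  case: Ht => [/alg Ha|[[t0 [a [Pa e]]]|[a [Pa a0 ->]]]].
  - by apply/adE; apply: (adjoin_der_alg Hd HdF Hi charF Ha).
  - rewrite -(divfK t0 (d t)) e; apply: (subfieldM aC); last exact: mem_adjoin_to.
    by apply: sub_adjoin_to; apply: dP.
  - apply: (subfieldM aC); first by apply: sub_adjoin_to; apply: dP.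
    by apply: (subfieldV aC); apply: sub_adjoin_to.
split; first exact: const_diff_subfield_adjoin.
move=> f /Pi [g ->] /(liouville_form_gen _ adE) Hf; apply/(liouville_form_gen _ Pi).
(* A generator introduced as a logarithm or an exponential may still be algebraic, so algebraicity
   is decided before the kind of generator. *)
have [a|/trans tt] := pselect algebraic.
  exact: (liouville_step_alg Hd HdF Hi charF a consts Hf).
case: Ht => [/alg [p p0 pt]|[[t0 [a [/Pi Pa e]]]|[a [/Pi Pa a0 e]]]].
- by have := tt p p0; rewrite pt eqxx.
- exact: (liouville_step_exp Hd HdF Hi tt consts e t0 Pa Hf).
- exact: (liouville_step_log Hd HdF Hi tt consts charF e a0 Pa Hf).
Qed.

(** The induction removes the lowest generator, with [P] generalised so that P(t) is the base of the
    remaining tower; the form descends to P(t), then to [P]. *)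
Lemma elementary_tower (ts : seq L) (P : L -> Prop) : const_diff_subfield P ->
  (forall k, (k < size ts)%N ->
     elementary_over d (gen_field (fun z => P z \/ z \in take k ts)) (nth 0 ts k)) ->
  forall f, P f -> liouville_form d (gen_field (fun z => P z \/ z \in ts)) f ->
  liouville_form d P f.
Proof.
elim: ts P => [|t ts IH] P HP Hts f Pf Hf.
  apply: liouville_form_sub Hf => y; apply: gen_field_sub; first by case: HP.
  by move=> s [].
have Ht : elementary_over d P t.
  apply: elementary_over_mono (Hts 0%N isT) => y; apply: gen_field_sub; first by case: HP.
  by move=> s [].
have [HQ HQP] := elementary_step HP Ht; apply: HQP => //.
have incl (us : seq L) y : gen_field (fun z => P z \/ z \in t :: us) y ->
    gen_field (fun z => adjoin_to P t z \/ z \in us) y.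
  apply: gen_field_mono => s [Ps|]; first by apply: mem_gen_field; left; apply: sub_adjoin_to.
  rewrite inE => /orP[/eqP->|su]; apply: mem_gen_field; last by right.
  by left; apply: mem_adjoin_to.
apply: (IH _ HQ); last by apply: liouville_form_sub Hf => y; apply: incl.
  move=> k sk; apply: elementary_over_mono (Hts k.+1 sk) => y; exact: incl.
exact: sub_adjoin_to.
Qed.

(** The base of the tower is raised from the image of [K] to [P], over which the generators remain
    elementary. At the top the form is trivial: [f] is the derivative of [g]. *)
Lemma liouville_elementary (E : fieldType) (K : E -> Prop) (j : E -> L) P f g :
  elementary_extension K j d -> const_diff_subfield P -> (forall e, K e -> P (j e)) ->
  P f -> f = d g -> liouville_form d P f.
Proof.
move=> [ts [gen Hts]] HP KP Pf fg.
have incl (us : seq L) y :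
    gen_field (fun z => (exists e, K e /\ z = j e) \/ z \in us) y ->
    gen_field (fun z => P z \/ z \in us) y.
  apply: gen_field_mono => s [[e [Ke ->]]|su]; apply: mem_gen_field; last by right.
  by left; apply: KP.
apply: (elementary_tower (ts := ts) HP _ Pf).
  move=> k sk; apply: elementary_over_mono (Hts k sk) => y; exact: incl.
by rewrite fg; apply: liouville_form_der; apply: incl; apply: gen.
Qed.

End Tower.

(** * Nonintegrability of log(x)/(x-a) *)

Lemma mul_deriv_XsubC_exp (F : fieldType) (a : F) n :
  ('X - a%:P) * (('X - a%:P) ^+ n)^`() = n%:R * ('X - a%:P) ^+ n.
Proof.
rewrite deriv_exp derivXsubC; case: n => [|n] /=; first by rewrite !mulr0n; ring.
by rewrite -mulr_natl exprS; ring.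
Qed.

(* This is [(p / q)' <> N / (('X - a) S)] with denominators cleared; the two sides have
   different multiplicities at [a]. *)
Lemma simple_pole_not_derivative (F : fieldType) (N S p q : {poly F}) (a : F) :
  (forall n, n.+1%:R != 0 :> F) -> q != 0 -> N.[a] != 0 -> S.[a] != 0 ->
  N * q ^+ 2 <> ('X - a%:P) * S * (p^`() * q - p * q^`()).
Proof.
move=> char0 q0 Na Sa; have [-> e|p0] := eqVneq p 0.
  have /eqP := e; rewrite deriv0 !mul0r subrr mulr0 mulf_eq0 expf_eq0 (negPf q0) orbF.
  by apply/negP; apply: contraNneq Na => ->; rewrite horner0.
have [m [p1 /implyP/(_ p0) p1a ->]] := multiplicity_XsubC p a.
have [n [q1 /implyP/(_ q0) q1a ->]] := multiplicity_XsubC q a.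
set y := 'X - a%:P.
have ya : y.[a] = 0 by rewrite hornerXsubC subrr.
have yX k : y.[a] ^+ k.+1 = 0 by rewrite ya expr0n.
have {}p1a : p1.[a] != 0 by [].
have {}q1a : q1.[a] != 0 by [].
(* The product of [y] and p' q - p q' equals y^(m+n) times [V]. The value of [V] at [a] is (m-n)
   p1(a) q1(a), so it vanishes exactly when m = n. *)
pose V := (m%:R - n%:R) * (p1 * q1) + y * (p1^`() * q1 - p1 * q1^`()).
have -> : y * S * ((p1 * y ^+ m)^`() * (q1 * y ^+ n) - p1 * y ^+ m * (q1 * y ^+ n)^`())
    = S * (y ^+ m * y ^+ n) * V.
  rewrite !derivM /V.
  transitivity (S * (y * (p1^`() * y ^+ m) * (q1 * y ^+ n)
      + p1 * (y * (y ^+ m)^`()) * (q1 * y ^+ n)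
      - p1 * y ^+ m * (y * (q1^`() * y ^+ n) + q1 * (y * (y ^+ n)^`())))); first by ring.
  by rewrite !mul_deriv_XsubC_exp -/y; ring.
have yn0 k : y ^+ k != 0 by rewrite expf_neq0 // polyXsubC_eq0.
move=> e.
have {}e : y ^+ n * (N * q1 ^+ 2) = y ^+ m * (S * V).
  apply: (mulfI (yn0 n)); transitivity (N * (q1 * y ^+ n) ^+ 2); first by ring.
  by rewrite e; ring.
have Va : V.[a] = (m%:R - n%:R) * (p1.[a] * q1.[a]).
  rewrite /V hornerD !hornerM ya mul0r addr0 !hornerE.
  by rewrite -!polyC_natr !hornerC.
have Na2 : (N * q1 ^+ 2).[a] != 0 by rewrite hornerM horner_exp mulf_neq0 ?expf_neq0.
(* The cases say that p/q has a pole, a zero or neither at [a]; its derivative has a pole of order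
   at least 2 there, or none. *)
case: (ltngtP m n) => mn.
- have en : n = (m + (n - m).-1.+1)%N by rewrite prednK ?subn_gt0 // subnKC // ltnW.
  have e' : y ^+ (n - m).-1.+1 * (N * q1 ^+ 2) = S * V.
    by apply: (mulfI (yn0 m)); rewrite -e [LHS]mulrA -exprD -en.
  have := congr1 (fun r : {poly F} => r.[a]) e'; apply/eqP.
  rewrite hornerM horner_exp yX mul0r hornerM Va eq_sym !mulf_neq0 //.
  rewrite subr_eq0 eq_sym -subr_eq0 -natrB ?(ltnW mn) //.
  by rewrite -(prednK (n := n - m)) ?subn_gt0 ?char0.
- have em : m = (n + (m - n).-1.+1)%N by rewrite prednK ?subn_gt0 // subnKC // ltnW.
  have e' : N * q1 ^+ 2 = y ^+ (m - n).-1.+1 * (S * V).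
    by apply: (mulfI (yn0 n)); rewrite e [RHS]mulrA -exprD -em.
  by move: Na2; rewrite e' hornerM horner_exp yX mul0r eqxx.
- move: e; rewrite mn => /(mulfI (yn0 n)) e'.
  by move: Na2; rewrite e' hornerM Va mn subrr mul0r mulr0 eqxx.
Qed.

Section DilogarithmBase.
Variables (L : fieldType) (d : L -> L).
Hypothesis Hd : is_derivation d.
Hypothesis char0 : forall n, n.+1%:R != 0 :> L.
Variable x : L.
Hypothesis dx : d x = 1.

Let const_field := fun c : L => d c = 0.
Let rational_field := adjoin_to const_field x.

Lemma const_diff_subfield_const : const_diff_subfield d const_field.
Proof.
split=> [|y dy|//]; first exact: const_closed.
by rewrite /const_field dy (der0 Hd).
Qed.

Lemma const_diff_subfield_rational : const_diff_subfield d rational_field.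
Proof.
apply: (const_diff_subfield_adjoin Hd const_diff_subfield_const).
by rewrite dx; apply: sub_adjoin_to; apply: der1.
Qed.

Section ConstantCoefficients.
Variables (F : fieldType) (i : {rmorphism F -> L}).
Hypothesis Hi : forall u, d (i u) = 0.
Hypothesis constE : forall y, const_field y <-> image_of i y.

Lemma der_zero : is_derivation (fun _ : F => 0 : F).
Proof. by split=> a b; rewrite ?addr0 // mul0r mulr0 addr0. Qed.

Lemma char0_image n : n.+1%:R != 0 :> F.
Proof. by rewrite -(fmorph_eq0 i) rmorph_nat. Qed.

(** If [x] were algebraic over the constants, descent of 1 = d x would make 1 the derivative of a
    constant. *)
Lemma x_transcendental (p : {poly F}) : p != 0 -> eval_at i x p != 0.
Proof.
move=> p0; apply/eqP=> px; have Hi' u : d (i u) = i 0 by rewrite Hi rmorph0.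
have xalg : exists2 p : {poly F}, p != 0 & eval_at i x p = 0 by exists p.
have [] := der_descent_alg Hd der_zero Hi' char0_image xalg (f := 1) (v := x).
- by rewrite rmorph1.
- by apply: mem_gen_field; right.
- by move=> _ /eqP; rewrite oner_eq0.
Qed.

Lemma der_ev_const (p : {poly F}) : d (eval_at i x p) = eval_at i x p^`().
Proof.
have Hi' u : d (i u) = i 0 by rewrite Hi rmorph0.
rewrite (der_ev_gen Hd der_zero Hi') dx mulr1.
suff -> : map_poly (fun _ : F => 0 : F) p = 0 by rewrite ev0 add0r.
by apply/polyP=> k; rewrite coef_map_id0 // coef0.
Qed.

Lemma rational_der_no_simple_pole (N S : {poly F}) a v :
  N.[a] != 0 -> S.[a] != 0 -> rational_field v ->
  d v <> eval_at i x N / eval_at i x (('X - a%:P) * S).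
Proof.
move=> Na Sa /(adjoin_toE _ _ constE) /(adjoin_frac x_transcendental) [p [q [q0 ->]]] e.
apply: (simple_pole_not_derivative char0_image q0 Na Sa (p := p)).
have S0 : S != 0 by apply: contraNneq Sa => ->; rewrite horner0.
have yS0 : ('X - a%:P) * S != 0 by rewrite mulf_neq0 // polyXsubC_eq0.
apply: (ev_inj x_transcendental); have q'0 := x_transcendental q0.
move: (x_transcendental yS0) e; rewrite (der_div Hd) // !der_ev_const.
move: (_ * S) => w w0 e; rewrite evM [RHS]evM expr2 evM evB !evM.
rewrite -(divfK w0 (eval_at i x N)) -e.
by field.
Qed.

End ConstantCoefficients.

Lemma const_field_image : exists (F : fieldType) (i : {rmorphism F -> L}),
  (forall u, d (i u) = 0) /\ forall y, const_field y <-> image_of i y.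
Proof.
have [F [i Fi]] := subfield_image (const_closed Hd).
by exists F, i; split=> // u; apply/Fi; exists u.
Qed.

Variable l : L.
Hypothesis dl : d l = x^-1.

Lemma log_poly_div_linear_not_liouville (p : {poly L}) a :
  (forall k, d p`_k = 0) -> d a = 0 -> a != 0 -> p.[a] != 0 ->
  ~ liouville_form d (adjoin_to rational_field l) (p.[x] / (x - a) * l).
Proof.
move=> dp da a0 pa; have [F0 [i0 [Hi0 cE]]] := const_field_image.
have [|q pq] := poly_image (i := i0) (p := p); first by move=> k; apply/cE/dp.
have [a' ea] : image_of i0 a by apply/cE.
have qa : q.[a'] != 0 by move: pa; rewrite pq ea horner_map fmorph_eq0.
have a'0 : a' != 0 by rewrite -(fmorph_eq0 i0) -ea.
have [F [i [dF [HdF Hi Pi consts charF]]]] :=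
  const_diff_subfield_image Hd char0 const_diff_subfield_rational.
have rC : subfield_closed rational_field := gen_field_closed _.
have rx : rational_field x by apply: mem_adjoin_to.
have evr (r : {poly F0}) : rational_field (eval_at i0 x r).
  by apply/(adjoin_toE _ _ cE); apply: ev_adjoin.
have x0 : x != 0.
  by have := x_transcendental Hi0 (p := 'X); rewrite evX; apply; rewrite polyX_eq0.
have xa : x - a != 0.
  have := x_transcendental Hi0 (p := 'X - a'%:P); rewrite evB evX evC ea; apply.
  by rewrite polyXsubC_eq0.
(* Algebraicity of [l] over C'(x) would make 1/x a derivative in C'(x), which its simple pole at 0
   excludes. *)
have l_trans (r : {poly F}) : r != 0 -> eval_at i l r != 0.
  move=> r0; apply/eqP=> rl; have lalg : exists2 r, r != 0 & eval_at i l r = 0 by exists r.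
  have /Pi[g xg] : rational_field x^-1 by apply: (subfieldV rC).
  have [||u gu] := der_descent_alg Hd HdF Hi charF lalg (f := g) (v := l).
  - by rewrite dl.
  - by apply: mem_gen_field; right.
  have ru : rational_field (i u) by apply/Pi; exists u.
  apply: (rational_der_no_simple_pole Hi0 cE (N := 1) (S := 1) (a := 0) _ _ ru).
  - by rewrite hornerC oner_neq0.
  - by rewrite hornerC oner_neq0.
  by rewrite Hi -gu -xg polyC0 subr0 mulr1 ev1 evX div1r.
have /Pi[f ef] : rational_field (p.[x] / (x - a)).
  rewrite pq; apply: (subfieldM rC); first exact: evr.
  apply: (subfieldV rC); apply: (subfieldB rC) => //.
  by apply: sub_adjoin_to.
have /Pi[g eg] : rational_field x^-1 by apply: (subfieldV rC).
have dlg : d l = i g by rewrite dl.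
rewrite ef => /(liouville_form_gen _ _ (fun y => adjoin_toE l y Pi)).
move=> /(primitive_adjoin_linear Hd HdF Hi l_trans consts charF dlg) [v [c [c0 fvc]]].
have rv : rational_field (i v) by apply/Pi; exists v.
have /cE[c' ec] : const_field (i c) by rewrite /const_field Hi c0 rmorph0.
(* Here v' = p/(x-a) - c/x has numerator x p - c (x-a) over (x-a) x. At [a] the numerator is a p(a)
   and the cofactor x is a, both nonzero. *)
apply: (rational_der_no_simple_pole Hi0 cE
  (N := q * 'X - c'%:P * ('X - a'%:P)) (S := 'X) (a := a') _ _ rv).
- by rewrite !hornerE subrr mulr0 subr0 mulf_neq0.
- by rewrite hornerX.
have qx : eval_at i0 x q = p.[x] by rewrite pq.
have -> : d (i v) = p.[x] / (x - a) - i c / x.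
  by rewrite ef fvc rmorphD rmorphM -eg addrK Hi.
by rewrite !evE qx -ea -ec; field; apply/andP.
Qed.

End DilogarithmBase.

(** * Integrating Laurent polynomials in x and log(x) *)

Section LaurentLog.
Variables (E : fieldType) (d : E -> E).
Hypothesis Hd : is_derivation d.
Hypothesis char0 : forall n, n.+1%:R != 0 :> E.
Variables (P : E -> Prop) (x l : E).
Hypotheses (HP : subfield_closed P) (dP : forall c, P c -> d c = 0).
Hypotheses (dx : d x = 1) (dl : d l = x^-1).

Inductive laurent_log_span : E -> Prop :=
| laurent_log_span0 : laurent_log_span 0
| laurent_log_spanS c (m : int) k w : P c -> laurent_log_span w ->
    laurent_log_span (c * x ^ m * l ^+ k + w).

Lemma laurent_log_spanD y z :
  laurent_log_span y -> laurent_log_span z -> laurent_log_span (y + z).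
Proof.
move=> Hy Hz; elim: Hy => [|c m k w Pc _ IH]; first by rewrite add0r.
by rewrite -addrA; apply: laurent_log_spanS.
Qed.

Lemma laurent_log_span_mono c (m : int) k : P c -> laurent_log_span (c * x ^ m * l ^+ k).
Proof.
by move=> Pc; rewrite -[X in laurent_log_span X]addr0; apply: laurent_log_spanS => //;
  apply: laurent_log_span0.
Qed.

Lemma laurent_log_span_sub (K : E -> Prop) y : subfield_closed K ->
  (forall c, P c -> K c) -> K x -> K l -> laurent_log_span y -> K y.
Proof.
move=> HK PK Kx Kl; elim=> [|c m k w Pc _ IH]; first exact: subfield0.
apply: (subfieldD HK) => //; apply: (subfieldM HK); last exact: subfieldX.
apply: (subfieldM HK); first exact: PK.
by case: m => n; [|apply: (subfieldV HK)]; apply: subfieldX.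
Qed.

Lemma primitive_base_neq0 : x != 0.
Proof. by apply: contra_eq_neq dx => ->; rewrite (der0 Hd) eq_sym oner_neq0. Qed.

Lemma der_exprz (m : int) : d (x ^ m) = m%:~R * (x ^ m / x).
Proof.
have x0 := primitive_base_neq0.
have pos n : d (x ^+ n) = n%:R * (x ^+ n / x).
  rewrite (derX Hd) dx; case: n => [|n]; first by rewrite !mul0r.
  by rewrite exprSr mulfK // mulr1.
case: m => n; first exact: pos.
rewrite NegzE -exprnN (derV Hd) pos mulrNz mulNr; congr (- _).
by have := expf_neq0 n.+1 x0; move: (x ^+ n.+1) => y y0; rewrite -pmulrn; field; apply/andP.
Qed.

Lemma intr_neq0 (m : int) : m != 0 -> m%:~R != 0 :> E.
Proof.
case: m => [[|n]|n] // _; first exact: char0.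
by rewrite NegzE mulrNz oppr_eq0 char0.
Qed.

(** For m = -1 the factor 1/x is the derivative of [l], and the exponent of [l] rises by one.
    Otherwise integration by parts lowers that exponent, and induction applies with a new constant
    [c]. *)
Lemma laurent_log_mono_primitive c (m : int) k : P c ->
  exists2 z, laurent_log_span z & d z = c * x ^ m * l ^+ k.
Proof.
move=> Pc; have x0 := primitive_base_neq0; have Pnat n : P n%:R.
  elim: n => [|n IH]; first exact: subfield0.
  by rewrite -natr1; apply: subfieldD => //; apply: subfield1.
have [->|m1] := eqVneq m (-1).
  have cP : P (c / k.+1%:R).
    by apply: (subfieldM HP) => //; apply: (subfieldV HP); apply: Pnat.
  exists (c / k.+1%:R * x ^ 0%Z * l ^+ k.+1); first exact: laurent_log_span_mono.
  rewrite (derM Hd) (derM Hd) (dP cP) expr0z (der1 Hd) (derX Hd) dl /= -[x ^ -1]/(x^-1).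
  by move: (k.+1%:R) (char0 k) => N N0; field; apply/andP.
have m10 : (m + 1)%:~R != 0 :> E by rewrite intr_neq0 // addr_eq0.
have Pint : P (m + 1)%:~R.
  case: (m + 1) => n; first exact: Pnat.
  by rewrite NegzE mulrNz; apply: (subfieldN HP); apply: Pnat.
have lead c' : P c' -> P (c' / (m + 1)%:~R) /\
    d (c' / (m + 1)%:~R * x ^ (m + 1)) = c' * x ^ m.
  move=> Pc'; have Q : P (c' / (m + 1)%:~R) by apply: (subfieldM HP) => //; apply: (subfieldV HP).
  split=> //; rewrite (derM Hd) (dP Q) mul0r add0r der_exprz.
  by rewrite expfzDr // expr1z mulfK // mulrA divfK.
elim: k c Pc => [|k IH] c Pc; have [Pm dm] := lead _ Pc.
  exists (c / (m + 1)%:~R * x ^ (m + 1) * l ^+ 0); first exact: laurent_log_span_mono.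
  by rewrite !expr0 !mulr1.
have [|z Wz dz] := IH (- (c / (m + 1)%:~R * k.+1%:R)).
  by apply: (subfieldN HP); apply: (subfieldM HP).
exists (c / (m + 1)%:~R * x ^ (m + 1) * l ^+ k.+1 + z).
  by apply: laurent_log_spanD => //; apply: laurent_log_span_mono.
rewrite (derD Hd) dz (derM Hd) dm (derX Hd) dl /= expfzDr // expr1z.
move: (x ^ m) (k.+1%:R) ((m + 1)%:~R) m10 => xm N M M0.
by field; apply/andP.
Qed.

Lemma laurent_log_primitive y : laurent_log_span y ->
  exists2 z, laurent_log_span z & d z = y.
Proof.
elim=> [|c m k w Pc _ [z Wz <-]].
  by exists 0; [apply: laurent_log_span0 | apply: der0].
have [z' Wz' <-] := laurent_log_mono_primitive m k Pc.
by exists (z' + z); [apply: laurent_log_spanD | apply: derD].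
Qed.

Lemma laurent_log_iter_primitive y n : laurent_log_span y ->
  exists2 z, laurent_log_span z & y = iter n d z.
Proof.
elim: n y => [|n IH] y Wy; first by exists y.
have [z Wz ->] := IH _ Wy; have [z' Wz' <-] := laurent_log_primitive Wz.
by exists z'; rewrite // iterSr.
Qed.

End LaurentLog.

(** * Integration by parts and differential embeddings *)

Lemma iterated_by_parts (L : fieldType) (d : L -> L) (x g : L) n (p : {poly L}) :
  is_derivation d -> d x = 1 -> (forall k, d p`_k = 0) -> (size p <= n)%N ->
  exists h, d h = p.[x] * iter n d g.
Proof.
move=> Hd dx; elim: n p => [|n IH] p dp sp.
  by exists 0; move: sp; rewrite leqn0 size_poly_eq0 => /eqP ->; rewrite horner0 mul0r der0.
have dpx : d p.[x] = p^`().[x].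
  have := der_ev_gen Hd Hd (i := idfun) (fun _ => erefl) x p.
  have idp (q : {poly L}) : map_poly idfun q = q by apply: map_poly_id.
  rewrite /eval_at !idp dx mulr1 => ->.
  suff -> : map_poly d p = 0 by rewrite horner0 add0r.
  by apply/polyP=> k; rewrite coef_map_id0 ?(der0 Hd) // coef0.
have [||h dh] := IH p^`().
- by move=> k; rewrite coef_deriv -mulr_natr (derM Hd) dp (der_nat Hd) mul0r mulr0 addr0.
- have [->|p0] := eqVneq p 0; first by rewrite deriv0 size_poly0.
  by rewrite -ltnS (leq_trans (lt_size_deriv p0)).
(* One derivative moves from [g] to [p]; as the size of [p] is at most the number of derivatives,
   [p] is exhausted when they run out. *)
exists (p.[x] * iter n d g - h).
by rewrite (derB Hd) (derM Hd) dh dpx /= addrAC subrr add0r.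
Qed.

Section DiffEmbedding.
Variables (E L : fieldType) (dE : E -> E) (dL : L -> L) (K : E -> Prop) (j : E -> L).
Hypotheses (HK : subfield_closed K) (Hj : diff_embedding_on dE dL K j).

Lemma embed0 : j 0 = 0.
Proof.
have [_ jD _ _] := Hj; have K0 := subfield0 HK.
by apply: (addrI (j 0)); rewrite -jD // !addr0.
Qed.

Lemma embedB a b : K a -> K b -> j (a - b) = j a - j b.
Proof.
have [_ jD _ _] := Hj => Ka Kb; apply: (addIr (j b)).
by rewrite -jD ?subrK //; apply: subfieldB.
Qed.

Lemma embedV a : K a -> j a^-1 = (j a)^-1.
Proof.
have [j1 _ jM _] := Hj => Ka; have [->|a0] := eqVneq a 0; first by rewrite invr0 embed0 invr0.
have jaV : j a * j a^-1 = 1 by rewrite -jM ?divff //; apply: subfieldV.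
have ja0 : j a != 0 by apply: contra_eq_neq jaV => ->; rewrite mul0r eq_sym oner_neq0.
by apply: (mulfI ja0); rewrite jaV divff.
Qed.

Lemma embed_gen (S : E -> Prop) (P : L -> Prop) : (forall e, K e <-> gen_field S e) ->
  subfield_closed P -> (forall s, S s -> P (j s)) -> forall e, K e -> P (j e).
Proof.
move=> KS HP SP e /KS Se; have [j1 jD jM _] := Hj.
have [//] : K e /\ P (j e).
apply: (gen_field_sub (P := fun e => K e /\ P (j e))) Se; last first.
  by move=> s Ss; split; [apply/KS; apply: mem_gen_field | apply: SP].
split.
- by rewrite j1; split; [apply: (subfield1 HK) | apply: (subfield1 HP)].
- move=> a b [Ka Pa] [Kb Pb]; rewrite embedB //.
  by split; [apply: (subfieldB HK) | apply: (subfieldB HP)].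
- move=> a b [Ka Pa] [Kb Pb]; rewrite jM //.
  by split; [apply: (subfieldM HK) | apply: (subfieldM HP)].
- move=> a [Ka Pa]; rewrite embedV //.
  by split; [apply: (subfieldV HK) | apply: (subfieldV HP)].
Qed.

Lemma embed_iter n g : (forall e, K e -> K (dE e)) -> K g ->
  K (iter n dE g) /\ j (iter n dE g) = iter n dL (j g).
Proof.
move=> dK Kg; have [_ _ _ jd] := Hj; elim: n => [//|n [Kn IH]] /=.
by split; [apply: dK | rewrite jd // IH].
Qed.

End DiffEmbedding.

(** * Poles of rational functions *)

Lemma frac_repr (T : idomainType) (f : {fraction T}) :
  exists p q : T, q != 0 /\ f = p%:F / q%:F.
Proof.
elim/quotW: f => r; exists r.1, r.2; rewrite denom_ratioP; split=> //.
apply: (mulIf (x := (r.2)%:F)); first by rewrite tofrac_eq0 denom_ratioP.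
rewrite divfK ?tofrac_eq0 ?denom_ratioP //.
apply/eqP; rewrite -[_ * _]/(FracField.mul _ _) !piE FracField.equivfE /FracField.mulf.
rewrite !numden_Ratio ?mulf_neq0 ?oner_neq0 ?denom_ratioP //.
by apply/eqP; ring.
Qed.

(** In lowest terms, the power of ['X] is split off the denominator. A constant cofactor means a
    Laurent polynomial; otherwise the cofactor has a root [a], nonzero by construction. The
    denominator stripped of one factor ['X - a] is a multiplier that works for a pole of any order,
    and the numerator is nonzero at [a] by coprimality. *)
Lemma frac_pole_or_laurent (C : closedFieldType) (f : {fraction {poly C}}) :
  (exists (p : {poly C}) n, f = p%:F / ('X^n)%:F) \/
  (exists (a : C) (q r : {poly C}), [/\ a != 0, r.[a] != 0
     & q%:F * f = r%:F / ('X - a%:P)%:F]).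
Proof.
have [P [Q [Q0 ef]]] := frac_repr f.
set g := gcdp P Q; have g0 : g != 0 by rewrite gcdp_eq0 negb_and Q0 orbT.
have {ef Q0} [p [q [q0 cpq ef]]] : exists p q : {poly C},
    [/\ q != 0, coprimep p q & f = p%:F / q%:F].
  have eP : P %/ g * g = P := divpK (dvdp_gcdl P Q).
  have eQ : Q %/ g * g = Q := divpK (dvdp_gcdr P Q).
  have q0 : Q %/ g != 0 by apply: contraNneq Q0 => e; rewrite -eQ e mul0r.
  exists (P %/ g), (Q %/ g); split=> //.
    by apply: coprimep_div_gcd; rewrite Q0 orbT.
  rewrite ef -[in LHS]eP -[in LHS]eQ !tofracM -mulf_div divff ?mulr1 //.
  by rewrite tofrac_eq0.
have [n [q1 /implyP/(_ q0) q10 eq]] := multiplicity_XsubC q 0.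
rewrite subr0 in eq.
have [s1|s1] := eqVneq (size q1) 1%N.
  left; have /size_poly1P[c c0 ec] : size q1 == 1%N by rewrite s1.
  exists (c^-1 *: p), n; rewrite ef eq ec -mul_polyC !tofracM invfM mulrA.
  congr (_ * _); rewrite mulrC; congr (_ * _).
  apply: (mulfI (x := (c%:P)%:F)); first by rewrite tofrac_eq0 polyC_eq0.
  by rewrite -tofracM -polyCM !divff ?tofrac_eq0 ?polyC_eq0 // polyC1 tofrac1.
right; have [a qa] := closed_rootP _ s1.
have a0 : a != 0 by apply: contraNneq q10 => <-.
have /factor_theorem[q' eq'] : root q a by rewrite eq rootM qa.
exists a, q', p; split=> //.
  apply/negP=> pa; have := coprimep_root cpq (pa : root p a).
  by rewrite eq hornerM (rootP qa) mul0r eqxx.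
rewrite ef eq' tofracM invfM mulrCA mulVKf //.
rewrite tofrac_eq0; apply: contraNneq q0 => q'0; by rewrite eq' q'0 mul0r.
Qed.

Section FractionEmbedding.
Variables (C : fieldType) (L : fieldType) (s : {rmorphism {fraction {poly C}} -> L}).

Definition frac_const : {rmorphism C -> L} := s \o @FracField.tofrac {poly C} \o polyC.

Lemma frac_polyE (p : {poly C}) : s p%:F = (map_poly frac_const p).[s 'X%:F].
Proof.
elim/poly_ind: p => [|p c IH]; first by rewrite tofrac0 !rmorph0 horner0.
rewrite tofracD tofracM !rmorphD !rmorphM /= IH map_polyX map_polyC.
by rewrite hornerD hornerM hornerX hornerC.
Qed.

Lemma frac_image_sub (P : L -> Prop) a : subfield_closed P ->
  (forall c, P (frac_const c)) -> P (s 'X%:F) -> P (s a).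
Proof.
move=> HP Pc Px; have [p [q [_ ->]]] := frac_repr a.
have PF (r : {poly C}) : P (s r%:F).
  elim/poly_ind: r => [|r c IH]; first by rewrite tofrac0 rmorph0; apply: subfield0.
  rewrite tofracD tofracM rmorphD rmorphM; apply: (subfieldD HP); last exact: Pc.
  exact: (subfieldM HP).
by rewrite fmorph_div; apply: (subfieldM HP) => //; apply: (subfieldV HP).
Qed.

End FractionEmbedding.

(** * The two implications over C(x) *)

Section LogExtension.
Variables (R : realType) (E : fieldType) (delta : E -> E).
Variables (iota : {rmorphism {fraction {poly R[i]}} -> E}) (ell : E).
Variable f : {fraction {poly R[i]}}.
Hypothesis Hd : is_derivation delta.
Hypothesis d_iota : forall p q : {poly R[i]}, delta (iota (p%:F / q%:F))
  = iota ((p^`() * q - p * q^`())%:F / (q * q)%:F).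
Hypothesis d_ell : delta ell = (iota 'X%:F)^-1.

Let K : E -> Prop := gen_field (fun z => (exists a, z = iota a) \/ z = ell).
Let HK : subfield_closed K := gen_field_closed _.

Lemma K_iota a : K (iota a).
Proof. by apply: mem_gen_field; left; exists a. Qed.

Lemma K_ell : K ell.
Proof. by apply: mem_gen_field; right. Qed.

Lemma d_iota_poly (p : {poly R[i]}) : delta (iota p%:F) = iota (p^`())%:F.
Proof.
have := d_iota p 1; rewrite tofrac1 divr1 => ->.
have -> : (1 : {poly R[i]})^`() = 0 by rewrite -polyC1 derivC.
by rewrite !mulr1 mulr0 subr0 tofrac1 divr1.
Qed.

Lemma d_iota_X : delta (iota 'X%:F) = 1.
Proof. by rewrite d_iota_poly derivX tofrac1 rmorph1. Qed.

Lemma d_iota_const c : delta (frac_const iota c) = 0.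
Proof. by rewrite /= d_iota_poly derivC tofrac0 rmorph0. Qed.

Lemma char0_frac (L : fieldType) (s : {rmorphism {fraction {poly R[i]}} -> L}) n :
  n.+1%:R != 0 :> L.
Proof. by rewrite -(rmorph_nat (frac_const s)) fmorph_eq0 pnatr_eq0. Qed.

Lemma K_delta y : K y -> K (delta y).
Proof.
apply: (der_gen_field Hd) => _ [[a ->]|->]; last first.
  by rewrite d_ell; apply: (subfieldV HK); apply: K_iota.
by have [p [q [_ ->]]] := frac_repr a; rewrite d_iota; apply: K_iota.
Qed.

(** All iterated primitives already lie in [K], so [K] itself, as a field type with no generator
    adjoined, is the elementary extension. *)
Lemma laurent_stable (p : {poly R[i]}) n : f = p%:F / ('X^n)%:F ->
  stable_over_elementary delta K (iota f * ell).
Proof.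
move=> ef k; have [F [iF KE]] := subfield_image HK.
have [|dF [HdF HiF]] := der_restrict (i := iF) Hd.
  by move=> u; apply/KE; apply: K_delta; apply/KE; exists u.
(* The inverse of [iF] on [K]; the value 0 off [K] is arbitrary. *)
have /choice [j Hj] : forall y, exists u, K y -> iF u = y.
  move=> y; have [Ky|nK] := pselect (K y); last by exists 0.
  by have [u ->] := (KE y).1 Ky; exists u.
have emb : diff_embedding_on delta dF K j.
  split=> [|a b Ka Kb|a b Ka Kb|a Ka]; apply: (fmorph_inj iF).
  - by rewrite rmorph1 Hj //; apply: (subfield1 HK).
  - by rewrite rmorphD !Hj //; apply: (subfieldD HK).
  - by rewrite rmorphM !Hj //; apply: (subfieldM HK).
  - by rewrite -HiF !Hj //; apply: K_delta.
have cP : subfield_closed (image_of (frac_const iota)) := image_of_closed _.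
have dP c : image_of (frac_const iota) c -> delta c = 0.
  by move=> [u ->]; apply: d_iota_const.
have [|z Wz ez] := laurent_log_iter_primitive Hd (char0_frac iota) cP dP d_iota_X d_ell
  (y := iota f * ell) k.
  rewrite ef fmorph_div tofracXn rmorphXn /= (frac_polyE iota p) horner_coef !mulr_suml.
  elim/big_ind: _ => [|a b|m _]; first exact: laurent_log_span0.
    exact: laurent_log_spanD.
  set x := iota _; have x0 : x != 0 by rewrite fmorph_eq0 tofrac_eq0 polyX_eq0.
  have -> : (map_poly (frac_const iota) p)`_m * x ^+ m / x ^+ n * ell
      = (map_poly (frac_const iota) p)`_m * x ^ (m%:Z - n%:Z) * ell ^+ 1.
    by rewrite expfzDr // exprnN mulrA.
  by apply: laurent_log_span_mono; rewrite coef_map; exists p`_m.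
have Kz : K z.
  apply: laurent_log_span_sub Wz => //; [|exact: K_iota|exact: K_ell].
  by move=> _ [u ->]; apply: K_iota.
exists F, dF, j; split=> //; last first.
  by exists (j z); rewrite ez; have [] := embed_iter emb k K_delta Kz.
exists [::]; split=> // y; apply: mem_gen_field; left; exists (iF y).
have Ky : K (iF y) by apply/KE; exists y.
by split=> //; apply: (fmorph_inj iF); rewrite Hj.
Qed.

Lemma stable_laurent : stable_over_elementary delta K (iota f * ell) ->
  exists (p : {poly R[i]}) (n : nat), f = p%:F / ('X^n)%:F.
Proof.
move=> st; have [//|[a [q [r [a0 ra eqf]]]]] := frac_pole_or_laurent f; exfalso.
(* Level [size q]: integration by parts against the multiplier [q] uses that many derivatives. *)
have [L [d [j [HdL emb elem [g eg]]]]] := st (size q).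
have [j1 jD jM jd] := emb.
pose s0 (u : {fraction {poly R[i]}}) := j (iota u).
have s0B : zmod_morphism s0.
  by move=> u v; rewrite /s0 rmorphB (embedB HK emb) //; apply: K_iota.
have s0M : monoid_morphism s0.
  split; first by rewrite /s0 rmorph1.
  by move=> u v; rewrite /s0 rmorphM jM //; apply: K_iota.
pose s : {rmorphism {fraction {poly R[i]}} -> L} :=
  HB.pack s0 (GRing.isZmodMorphism.Build _ _ s0 s0B) (GRing.isMonoidMorphism.Build _ _ s0 s0M).
have sE u : j (iota u) = s u by [].
have char0 := char0_frac s; set x := s 'X%:F; pose l := j ell.
have dx : d x = 1 by rewrite -[x]sE -jd ?d_iota_X // ; apply: K_iota.
have dl : d l = x^-1 by rewrite -jd ?d_ell ?(embedV HK emb) //; [exact: K_iota|exact: K_ell].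
have dc c : d (frac_const s c) = 0.
  rewrite -[frac_const s c]/(j (frac_const iota c)) -jd ?d_iota_const ?(embed0 HK emb) //.
  exact: K_iota.
(* The field C'(x)(l), with C' all constants of [L]; it contains the image of [K]. *)
pose P := adjoin_to (adjoin_to (fun c => d c = 0) x) l.
have HP : const_diff_subfield d P.
  apply: (const_diff_subfield_adjoin HdL); first by apply: const_diff_subfield_rational.
  have rC : subfield_closed (adjoin_to (fun c => d c = 0) x) := gen_field_closed _.
  rewrite dl; apply: sub_adjoin_to; apply: (subfieldV rC).
  exact: mem_adjoin_to.
have PC : subfield_closed P by case: HP.
have KP e : K e -> P (j e).
  apply: (embed_gen HK emb (S := fun z => (exists a, z = iota a) \/ z = ell)) => //.
  move=> _ [[u ->]|->]; last exact: mem_adjoin_to.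
  rewrite sE; apply: sub_adjoin_to; apply: (frac_image_sub (s := s) (P := adjoin_to _ x)).
  - exact: gen_field_closed.
  - by move=> c; apply: sub_adjoin_to; apply: dc.
  - exact: mem_adjoin_to.
have [|h dh] := iterated_by_parts g (p := map_poly (frac_const s) q) HdL dx _ (leqnn _).
  by move=> k; rewrite coef_map; apply: dc.
rewrite size_map_poly -eg -frac_polyE (jM _ _ (K_iota _) K_ell) mulrA sE -rmorphM eqf in dh.
have [||||] := log_poly_div_linear_not_liouville HdL char0 dx dl
  (p := map_poly (frac_const s) r) (a := frac_const s a).
- by move=> k; rewrite coef_map; apply: dc.
- exact: dc.
- by rewrite fmorph_eq0.
- by rewrite horner_map fmorph_eq0.
have e : (map_poly (frac_const s) r).[x] / (x - frac_const s a) * l = d h.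
  by rewrite dh fmorph_div tofracB rmorphB frac_polyE.
apply: (liouville_elementary HdL char0 elem HP KP _ e).
rewrite e dh -sE; apply: (subfieldM PC); first by apply: KP; apply: K_iota.
by apply: KP; apply: K_ell.
Qed.

End LogExtension.

(* C = R[i] with R the real numbers (any realType), C(x) = {fraction {poly C}},
   E a differential field containing C(x) via the ring morphism iota. *)
Theorem theorem3p10 (R : realType) (E : fieldType) (delta : E -> E)
  (iota : {rmorphism {fraction {poly R[i]}} -> E})
  (ell : E) (f : {fraction {poly R[i]}}) :
  is_derivation delta ->
  (* delta restricts to d/dx on C(x) *)
  (forall p q : {poly R[i]},
      delta (iota (p%:F / q%:F))
      = iota ((p^`() * q - p * q^`())%:F / (q * q)%:F)) ->
  (* the field of constants of E is C *)
  (forall e : E, delta e = 0 -> exists c : R[i], e = iota (c%:P)%:F) ->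
  (* ell is transcendental over C(x) *)
  (forall P : {poly {fraction {poly R[i]}}}, P != 0 -> (map_poly iota P).[ell] != 0) ->
  delta ell = (iota ('X)%:F)^-1 ->
  let K := gen_field (fun z => (exists a, z = iota a) \/ z = ell) in
  stable_over_elementary delta K (iota f * ell)
  <-> (exists (p : {poly R[i]}) (n : nat), f = p%:F / ('X^n)%:F).
Proof.
move=> Hd d_iota _ _ d_ell K; split; first exact: stable_laurent.
by move=> [p [n ef]]; apply: laurent_stable ef.
Qed.
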